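(* Let $\bar{\mathcal Q}$ and $\bar{\mathcal R}$ denote the results computed in floating-point arithmetic by the algorithm BCGSI+A applied to $\mathcal X\in\mathbb R^{m\times ps}$ with intraorthogonalization routines $\mathrm{IO}_A,\mathrm{IO}_1,\mathrm{IO}_2$. Assume that for all $X\in\mathbb R^{m\times s}$ with $\kappa(X)\le\kappa(\mathcal X)$, the following hold for the computed $[\bar Q,\bar R]=\mathrm{IO}_A(X)$: $$X+\Delta X=\bar Q\bar R,\quad \|\Delta X\|\le O(\varepsilon)\|X\|,\qquad \|I-\bar Q^T\bar Q\|\le O(\varepsilon).$$ Likewise, assume the following hold for the computed $[\bar Q,\bar R]=\mathrm{IO}_1(X)$ and $[\bar Q,\bar R]=\mathrm{IO}_2(X)$, respectively: $$X+\Delta X=\bar Q\bar R,\quad \|\Delta X\|\le O(\varepsilon)\|X\|,\qquad \|I-\bar Q^T\bar Q\|\le O(\varepsilon)\,\kappa^{\alpha_1}(X);$$ and $$X+\Delta X=\bar Q\bar R,\quad \|\Delta X\|\le O(\varepsilon)\|X\|,\qquad \|I-\bar Q^T\bar Q\|\le O(\varepsilon)\,\kappa^{\alpha_2}(X).$$ If $O(\varepsilon)\,\kappa^{\theta}(\mathcal X)<1$ for $\theta:=\max(\alpha_1,1)$, then $$\mathcal X+\Delta\mathcal X=\bar{\mathcal Q}\bar{\mathcal R},\quad\|\Delta\mathcal X\|\le O(\varepsilon)\|\mathcal X\|,$$ and $$\|I-\bar{\mathcal Q}^T\bar{\mathcal Q}\|\le O(\varepsilon).$$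
   Context: Conventions. $m,s,p$ are positive integers with $m\ge ps$; $\mathcal X=[X_1\ X_2\ \cdots\ X_p]\in\mathbb R^{m\times ps}$ with block vectors $X_k\in\mathbb R^{m\times s}$. $\|\cdot\|$ is the induced 2-norm and $\kappa(\cdot)$ is the 2-norm condition number (ratio of largest to smallest singular value); $\kappa^{\alpha}(X)=(\kappa(X))^\alpha$, with nonnegative real exponents. Computations are carried out in floating-point arithmetic (standard model) with unit roundoff $\varepsilon$, and bars denote computed quantities. $O(\varepsilon)$ denotes a quantity bounded by $c\,\varepsilon$, where $c$ depends only on the dimensions $m,s,p$ (and the fixed exponents) and may differ at each occurrence; a hypothesis involving $O(\varepsilon)$ means that it holds with a suitable (sufficiently large) such constant. An intraorthogonalization routine $\mathrm{IO}$ takes $X\in\mathbb R^{m\times s}$ and returns $[Q,R]$, where in exact arithmetic $X=QR$, $Q\in\mathbb R^{m\times s}$, $Q^TQ=I$, and $R\in\mathbb R^{s\times s}$ is upper triangular. Notation. $\mathcal Q_k=[Q_1\ \cdots\ Q_k]$; $\mathcal R=(R_{ij})$, $\mathcal S=(S_{ij})$, $\mathcal T=(T_{ij})$ have $s\times s$ blocks; a subscript $1{:}k-1,k$ denotes the block column with block rows $1,\dots,k-1$ and block column $k$. Algorithm BCGSI+A($\mathcal X,\mathrm{IO}_A,\mathrm{IO}_1,\mathrm{IO}_2$): $[Q_1,R_{11}]=\mathrm{IO}_A(X_1)$. For $k=2,\dots,p$: $\mathcal S_{1:k-1,k}=\mathcal Q_{k-1}^TX_k$; $[U_k,S_{kk}]=\mathrm{IO}_1(X_k-\mathcal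 Q_{k-1}\mathcal S_{1:k-1,k})$; $\mathcal T_{1:k-1,k}=\mathcal Q_{k-1}^TU_k$; $[Q_k,T_{kk}]=\mathrm{IO}_2(U_k-\mathcal Q_{k-1}\mathcal T_{1:k-1,k})$; $\mathcal R_{1:k-1,k}=\mathcal S_{1:k-1,k}+\mathcal T_{1:k-1,k}S_{kk}$; $R_{kk}=T_{kk}S_{kk}$. Return $\mathcal Q=[Q_1,\dots,Q_p]$ and $\mathcal R=(R_{ij})$.
   Formalization: The assumptions on IO_1 and IO_2 are required for κ(X) ≤ (1+O(ε)κ^θ(𝒳))κ(𝒳) instead of κ(X) ≤ κ(𝒳), since rounding can push their inputs slightly beyond κ(𝒳) (e.g. 𝒳 = I_4), where the literal claim fails. *)

(* Defs.v *)
From HB Require Import structures.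
From mathcomp Require Import all_boot all_order all_algebra.
From mathcomp Require Import all_classical all_reals all_analysis.

Set Implicit Arguments.
Unset Strict Implicit.
Unset Printing Implicit Defensive.

Import Order.TTheory GRing.Theory Num.Theory.

Local Open Scope classical_set_scope.
Local Open Scope ring_scope.

Section SpectralQuantities.
Variable R : realType.

Definition l2norm n (x : 'cV[R]_n) : R := Num.sqrt (\sum_i x i 0 ^+ 2).

Definition norm2 m n (A : 'M[R]_(m, n)) : R :=
  sup [set l2norm (A *m x) | x in [set x : 'cV[R]_n | l2norm x = 1]].

(* Singular values of A as the square roots of the eigenvalues of A^T A; this
   is the usual list of n singular values when n <= m (for n > m it contains
   additional zeros). *)
Definition singular_values m n (A : 'M[R]_(m, n)) : set R :=
  [set sigma | 0 <= sigma /\ eigenvalue (A^T *m A) (sigma ^+ 2)].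

Definition sigma_max m n (A : 'M[R]_(m, n)) : R := sup (singular_values A).

Definition sigma_min m n (A : 'M[R]_(m, n)) : R := inf (singular_values A).

(* The value is extended real: a rank-deficient matrix has condition number
   +oo, whereas the total division of R would give 0. *)
Definition kappa m n (A : 'M[R]_(m, n)) : \bar R :=
  if sigma_min A == 0 then +oo%E else (sigma_max A / sigma_min A)%:E.

End SpectralQuantities.

(* Standard model of floating-point arithmetic with unit roundoff u. Computed
   results are described by relations: every result compatible with the model
   is allowed, and inner products may be accumulated in any order. *)
Section FloatingPoint.
Variables (R : realType) (u : R).

Definition fl (x y : R) : Prop := exists2 d, `|d| <= u & y = x * (1 + d).

(* The parts s1 and s2 must be nonempty: otherwise a sum could be rounded
   arbitrarily often by repeatedly adding an empty sum. *)
Inductive fl_sum : seq R -> R -> Prop :=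
| fl_sum_nil : fl_sum [::] 0
| fl_sum_one x : fl_sum [:: x] x
| fl_sum_add s s1 s2 x1 x2 x of
    perm_eq s (s1 ++ s2) & s1 != [::] & s2 != [::] &
    fl_sum s1 x1 & fl_sum s2 x2 & fl (x1 + x2) x : fl_sum s x.

Definition fl_mulmx m n q (A : 'M[R]_(m, n)) (B : 'M[R]_(n, q))
    (C : 'M[R]_(m, q)) : Prop :=
  forall i j, exists2 t : 'I_n -> R,
    forall l, fl (A i l * B l j) (t l) &
    fl_sum [seq t l | l <- enum 'I_n] (C i j).

Definition fl_addmx m n (A B C : 'M[R]_(m, n)) : Prop :=
  forall i j, fl (A i j + B i j) (C i j).

Definition fl_submx m n (A B C : 'M[R]_(m, n)) : Prop :=
  forall i j, fl (A i j - B i j) (C i j).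

(* C is a computed value of Z + A B *)
Definition fl_addmul m n q (Z : 'M[R]_(m, q)) (A : 'M[R]_(m, n))
    (B : 'M[R]_(n, q)) (C : 'M[R]_(m, q)) : Prop :=
  exists2 P, fl_mulmx A B P & fl_addmx Z P C.

(* C is a computed value of Z - A B *)
Definition fl_submul m n q (Z : 'M[R]_(m, q)) (A : 'M[R]_(m, n))
    (B : 'M[R]_(n, q)) (C : 'M[R]_(m, q)) : Prop :=
  exists2 P, fl_mulmx A B P & fl_submx Z P C.

End FloatingPoint.

Section Algorithm.
Variables (R : realType) (m s : nat).

(* The computed values [Q, R] returned by an intraorthogonalization routine. *)
Definition io_routine := 'M[R]_(m, s) -> 'M[R]_(m, s) * 'M[R]_s.

Definition io_residual_le (IO : io_routine) (b : R) (X : 'M[R]_(m, s)) : Prop :=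
  exists2 dX : 'M[R]_(m, s),
    X + dX = (IO X).1 *m (IO X).2 & norm2 dX <= b * norm2 X.

Definition brow (k : nat) (Q : nat -> 'M[R]_(m, s)) :
  'M[R]_(m, \sum_(j < k) s) := \mxrow_(j < k) Q j.

(* Block rows 0, ..., k-1 of block column k. *)
Definition bcol_above (k : nat) (S : nat -> nat -> 'M[R]_s) :
  'M[R]_(\sum_(i < k) s, s) := \mxcol_(i < k) S i k.

Definition bsquare (p : nat) (S : nat -> nat -> 'M[R]_s) :
  'M[R]_(\sum_(i < p) s, \sum_(j < p) s) := \mxblock_(i < p, j < p) S i j.

(* One pass k of the loop (block indices start at 0). W and V are the computed
   arguments of IO1 and IO2. *)
Definition bcgsiA_step (u : R) (IO1 IO2 : io_routine)
    (X Q U : nat -> 'M[R]_(m, s)) (S T RR : nat -> nat -> 'M[R]_s)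
    (k : nat) : Prop :=
  exists W V : 'M[R]_(m, s),
    [/\ fl_mulmx u (brow k Q)^T (X k) (bcol_above k S),
        fl_submul u (X k) (brow k Q) (bcol_above k S) W /\
          IO1 W = (U k, S k k),
        fl_mulmx u (brow k Q)^T (U k) (bcol_above k T),
        fl_submul u (U k) (brow k Q) (bcol_above k T) V /\
          IO2 V = (Q k, T k k) &
        fl_addmul u (bcol_above k S) (bcol_above k T) (S k k)
            (bcol_above k RR) /\
          fl_mulmx u (T k k) (S k k) (RR k k)].

(* QQ and RRR are results of BCGSI+A for the input XX of p block columns,
   computed with unit roundoff u. The families X, Q, U, S, T, RR are relevant
   for block indices below p only. *)
Definition bcgsiA_computed (p : nat) (u : R) (IOA IO1 IO2 : io_routine)
    (XX QQ : 'M[R]_(m, \sum_(j < p) s))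
    (RRR : 'M[R]_(\sum_(i < p) s, \sum_(j < p) s)) : Prop :=
  exists (X Q U : nat -> 'M[R]_(m, s)) (S T RR : nat -> nat -> 'M[R]_s),
    [/\ [/\ XX = brow p X, QQ = brow p Q & RRR = bsquare p RR],
        IOA (X 0%N) = (Q 0%N, RR 0%N 0%N),
        forall k, (0 < k < p)%N -> bcgsiA_step u IO1 IO2 X Q U S T RR k &
        forall i j, (j < i < p)%N -> RR i j = 0].

End Algorithm.

(* Main.v *)
(* The condition number of W = X_k - Q S, the input of IO_1, is controlled by
   writing W y = [X + dX, X_k + E] [-z; y], where X + dX = Q R and R z = S y:
   the smallest singular value drops by at most O(eps) |XX|.  Hence U has
   |I - U^T U| = O(eps) kappa^alpha_1, and since Q^T U S_kk = Q^T W + O(eps) |XX|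
   = O(eps) |XX| while the smallest singular value of S_kk is at least a constant
   times that of XX, Q^T U = O(eps) kappa.  So V = U - Q T is within
   O(eps) kappa^theta of a matrix with orthonormal columns, kappa V is bounded,
   IO_2 returns Q_k orthonormal up to O(eps), and the same argument, now with
   T_kk of bounded condition number, gives Q^T Q_k = O(eps). *)
Require Import Defs.
From HB Require Import structures.
From mathcomp Require Import all_boot all_order all_algebra.
From mathcomp Require Import all_classical all_reals all_analysis.
From mathcomp Require Import ring lra.

Set Implicit Arguments.
Unset Strict Implicit.
Unset Printing Implicit Defensive.

Import Order.TTheory GRing.Theory Num.Theory.

Local Open Scope ring_scope.

(** Only two small quantities occur in the estimates: the roundoff [u], and [h] with [u <= h] and
    [u * nu <= h * sigma], where [nu] and [sigma] bound the input from above and below. Real powers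
    of the condition number enter only at the end, where [h] becomes eps kappa^theta. The first pass
    loses orthogonality of order [h]. The second needs [h] small only to keep kappa V bounded; its
    own errors are of order [u], since nothing there is divided by [sigma]. Residuals are never
    divided by [sigma] either, so they stay O(u) [nu]. For kappa W a merely bounded factor would not
    do, because IO_1 is controlled only slightly beyond kappa of the input. This forces bounds of
    the form 1 + O(h) for the first projection. *)

Section L2norm.
Variable R : realType.

Lemma l2norm_ge0 n (x : 'cV[R]_n) : 0 <= l2norm x.
Proof. exact: sqrtr_ge0. Qed.

Lemma l2norm_sqr n (x : 'cV[R]_n) : l2norm x ^+ 2 = (x^T *m x) 0 0.
Proof.
rewrite sqr_sqrtr; last by apply: sumr_ge0 => i _; rewrite sqr_ge0.
by rewrite mxE; apply: eq_bigr => i _; rewrite mxE expr2.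
Qed.

Lemma dotC n (x y : 'cV[R]_n) : (x^T *m y) 0 0 = (y^T *m x) 0 0.
Proof. by rewrite -[x^T *m y]trmxK [in LHS]mxE trmx_mul trmxK. Qed.

Lemma l2norm0 n : l2norm (0 : 'cV[R]_n) = 0.
Proof. by rewrite /l2norm big1 ?sqrtr0 // => i _; rewrite mxE expr0n. Qed.

Lemma l2norm_eq0 n (x : 'cV[R]_n) : l2norm x = 0 -> x = 0.
Proof.
move=> x0; have := l2norm_sqr x; rewrite x0 expr0n /= mxE => /esym/eqP.
rewrite psumr_eq0 => [/allP h|i _]; last by rewrite mxE -expr2 sqr_ge0.
apply/colP => i; rewrite !mxE; apply/eqP.
by have := h i (mem_index_enum _); rewrite !mxE -expr2 /= sqrf_eq0.
Qed.

Lemma l2normZ n a (x : 'cV[R]_n) : l2norm (a *: x) = `|a| * l2norm x.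
Proof.
rewrite /l2norm -sqrtr_sqr -sqrtrM ?sqr_ge0// mulr_sumr.
by congr Num.sqrt; apply: eq_bigr => i _; rewrite mxE exprMn.
Qed.

Lemma l2normN n (x : 'cV[R]_n) : l2norm (- x) = l2norm x.
Proof. by rewrite -scaleN1r l2normZ normrN1 mul1r. Qed.

Lemma dotDl n (x y z : 'cV[R]_n) :
  ((x + y)^T *m z) 0 0 = (x^T *m z) 0 0 + (y^T *m z) 0 0.
Proof. by rewrite linearD mulmxDl [in LHS]mxE. Qed.

Lemma dotZl n a (x z : 'cV[R]_n) : ((a *: x)^T *m z) 0 0 = a * (x^T *m z) 0 0.
Proof. by rewrite linearZ -scalemxAl [in LHS]mxE. Qed.

Lemma dotDr n (x y z : 'cV[R]_n) :
  (z^T *m (x + y)) 0 0 = (z^T *m x) 0 0 + (z^T *m y) 0 0.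
Proof. by rewrite mulmxDr [in LHS]mxE. Qed.

Lemma dotZr n a (x z : 'cV[R]_n) : (z^T *m (a *: x)) 0 0 = a * (z^T *m x) 0 0.
Proof. by rewrite -scalemxAr [in LHS]mxE. Qed.

Lemma l2norm_sqrD n (x y : 'cV[R]_n) :
  l2norm (x + y) ^+ 2 = l2norm x ^+ 2 + 2 * (x^T *m y) 0 0 + l2norm y ^+ 2.
Proof.
rewrite !l2norm_sqr dotDl !dotDr (dotC y x); ring.
Qed.

(** Cauchy-Schwarz from positivity of |N x - d y|^2 = N (N |x|^2 - d^2), with N = |y|^2 and d the
    inner product; scaling by N avoids a division. *)
Lemma dot_sqr_le n (x y : 'cV[R]_n) :
  (x^T *m y) 0 0 ^+ 2 <= l2norm x ^+ 2 * l2norm y ^+ 2.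
Proof.
have [y0|yN0] := eqVneq (l2norm y) 0.
  by rewrite (l2norm_eq0 y0) mulmx0 mxE expr0n /= l2norm0 expr0n mulr0.
have N0 : 0 < l2norm y ^+ 2 by rewrite exprn_gt0 // lt_def yN0 l2norm_ge0.
set d := (x^T *m y) 0 0; set N := l2norm y ^+ 2 in N0 *.
have : 0 <= l2norm (N *: x + (- d) *: y) ^+ 2 by rewrite sqr_ge0.
rewrite l2norm_sqrD !l2normZ !exprMn !real_normK ?num_real // dotZl dotC dotZl dotC -/d -/N.
move=> h; rewrite -subr_ge0 -(pmulr_rge0 _ N0).
by apply: le_trans h _; rewrite le_eqVlt; apply/orP; left; apply/eqP; ring.
Qed.

Lemma dot_le n (x y : 'cV[R]_n) : `|(x^T *m y) 0 0| <= l2norm x * l2norm y.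
Proof.
rewrite -(@ler_pXn2r _ 2) ?nnegrE ?mulr_ge0 ?l2norm_ge0 //.
by rewrite real_normK ?num_real // exprMn dot_sqr_le.
Qed.

Lemma l2normD n (x y : 'cV[R]_n) : l2norm (x + y) <= l2norm x + l2norm y.
Proof.
rewrite -(@ler_pXn2r _ 2) ?nnegrE ?addr_ge0 ?l2norm_ge0 //.
rewrite l2norm_sqrD; have := dot_le x y; have := ler_norm ((x^T *m y) 0 0).
by move: (_ 0 0) => d; lra.
Qed.

Lemma l2norm_subl n (x y : 'cV[R]_n) : l2norm x - l2norm y <= l2norm (x + y).
Proof. by rewrite lerBlDr -{1}(addrK y x) -(l2normN y) l2normD. Qed.

Lemma l2norm_col_mx n1 n2 (x : 'cV[R]_n1) (y : 'cV[R]_n2) :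
  l2norm (col_mx x y) ^+ 2 = l2norm x ^+ 2 + l2norm y ^+ 2.
Proof. by rewrite !l2norm_sqr tr_col_mx mul_row_col mxE. Qed.

Lemma l2norm_le_sqr n1 n2 (x : 'cV[R]_n1) (y : 'cV[R]_n2) :
  l2norm x ^+ 2 <= l2norm y ^+ 2 -> l2norm x <= l2norm y.
Proof. by rewrite ler_pXn2r // nnegrE l2norm_ge0. Qed.

Lemma l2norm_col_mxu n1 n2 (x : 'cV[R]_n1) (y : 'cV[R]_n2) :
  l2norm x <= l2norm (col_mx x y).
Proof. by apply: l2norm_le_sqr; rewrite l2norm_col_mx lerDl sqr_ge0. Qed.

Lemma l2norm_col_mxd n1 n2 (x : 'cV[R]_n1) (y : 'cV[R]_n2) :
  l2norm y <= l2norm (col_mx x y).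
Proof. by apply: l2norm_le_sqr; rewrite l2norm_col_mx lerDr sqr_ge0. Qed.

Lemma l2norm_col_mx0 n1 n2 (x : 'cV[R]_n1) :
  l2norm (col_mx x (0 : 'cV_n2)) = l2norm x.
Proof.
apply/le_anti; rewrite l2norm_col_mxu andbT.
by apply: l2norm_le_sqr; rewrite l2norm_col_mx l2norm0 expr0n addr0.
Qed.

Lemma l2norm_col_0mx n1 n2 (x : 'cV[R]_n2) :
  l2norm (col_mx (0 : 'cV_n1) x) = l2norm x.
Proof.
apply/le_anti; rewrite l2norm_col_mxd andbT.
by apply: l2norm_le_sqr; rewrite l2norm_col_mx l2norm0 expr0n add0r.
Qed.

Lemma l2norm_delta n (i : 'I_n) : l2norm (delta_mx i 0 : 'cV[R]_n) = 1.
Proof.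
rewrite /l2norm (bigD1 i) //= !mxE !eqxx expr1n big1 ?addr0 ?sqrtr1 // => j ji.
by rewrite mxE (negbTE ji) expr0n.
Qed.

Lemma coord_le_l2norm n (x : 'cV[R]_n) i : `|x i 0| <= l2norm x.
Proof.
rewrite -sqrtr_sqr ler_sqrt; last by apply: sumr_ge0 => j _; rewrite sqr_ge0.
by rewrite (bigD1 i) //= lerDl; apply: sumr_ge0 => j _; rewrite sqr_ge0.
Qed.

Lemma l2norm_sum (I : Type) (r : seq I) n (F : I -> 'cV[R]_n) :
  l2norm (\sum_(i <- r) F i) <= \sum_(i <- r) l2norm (F i).
Proof.
elim/big_rec2: _ => [|i y x _ h]; first by rewrite l2norm0.
by apply: le_trans (l2normD _ _) _; rewrite lerD2l.
Qed.

End L2norm.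

(** * The induced 2-norm *)

Section Norm2.
Variable R : realType.
Local Open Scope classical_set_scope.

(** Crude, but it shows that the supremum defining [norm2] is over a bounded set, and it turns
    entrywise rounding errors into norm bounds whose constants depend on the dimensions only. *)
Lemma l2norm_mulmx_entries m n (A : 'M[R]_(m, n)) (x : 'cV[R]_n) :
  l2norm (A *m x) <= (\sum_i \sum_j `|A i j|) * l2norm x.
Proof.
have -> : A *m x = \sum_i (\sum_j A i j * x j 0) *: delta_mx i 0.
  rewrite [LHS]matrix_sum_delta; apply: eq_bigr => i _.
  by rewrite big_ord_recl big_ord0 addr0 !mxE.
apply: le_trans (l2norm_sum _ _) _; rewrite mulr_suml; apply: ler_sum => i _.
rewrite l2normZ l2norm_delta mulr1 mulr_suml.
apply: le_trans (ler_norm_sum _ _ _) _; apply: ler_sum => j _.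
by rewrite normrM ler_wpM2l // coord_le_l2norm.
Qed.

Let image m n (A : 'M[R]_(m, n)) :=
  [set l2norm (A *m x) | x in [set x : 'cV[R]_n | l2norm x = 1]].

Lemma norm2_has_ubound m n (A : 'M[R]_(m, n)) : has_ubound (image A).
Proof.
exists (\sum_i \sum_j `|A i j|) => _ [x /= x1 <-].
by rewrite (le_trans (l2norm_mulmx_entries _ _)) // x1 mulr1.
Qed.

Lemma l2norm_normalize n (x : 'cV[R]_n) : l2norm x != 0 ->
  l2norm ((l2norm x)^-1 *: x) = 1.
Proof.
by move=> x0; rewrite l2normZ ger0_norm ?invr_ge0 ?l2norm_ge0 // mulVf.
Qed.

Lemma l2norm_mulmx m n (A : 'M[R]_(m, n)) (x : 'cV[R]_n) :
  l2norm (A *m x) <= norm2 A * l2norm x.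
Proof.
have [x0|xN0] := eqVneq (l2norm x) 0.
  by rewrite (l2norm_eq0 x0) mulmx0 !l2norm0 mulr0.
have x_gt0 : 0 < l2norm x by rewrite lt_def xN0 l2norm_ge0.
rewrite -ler_pdivrMr // mulrC.
rewrite -[X in X * _]ger0_norm ?invr_ge0 ?l2norm_ge0 // -l2normZ scalemxAr.
apply: ub_le_sup; first exact: norm2_has_ubound.
by exists ((l2norm x)^-1 *: x) => //=; exact: l2norm_normalize.
Qed.

Lemma norm2_le m n (A : 'M[R]_(m, n)) b : 0 <= b ->
  (forall x : 'cV[R]_n, l2norm (A *m x) <= b * l2norm x) -> norm2 A <= b.
Proof.
move=> b0 h; rewrite /norm2 -/(image A).
(* Without columns there is no unit vector, and the supremum of the empty set is 0. *)
have [->|/set0P ne] := eqVneq (image A) set0; first by rewrite sup0.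
by apply: ge_sup => // _ [x /= x1 <-]; rewrite -[b]mulr1 -x1.
Qed.

Lemma norm2_ge0 m n (A : 'M[R]_(m, n)) : 0 <= norm2 A.
Proof.
have [E|/set0P [y Ay]] := eqVneq (image A) set0.
  by rewrite /norm2 -/(image A) E sup0.
apply: le_trans (ub_le_sup (norm2_has_ubound A) Ay).
by case: Ay => x _ <-; exact: l2norm_ge0.
Qed.

Lemma norm2D m n (A B : 'M[R]_(m, n)) : norm2 (A + B) <= norm2 A + norm2 B.
Proof.
apply: norm2_le => [|x]; first by rewrite addr_ge0 ?norm2_ge0.
rewrite mulmxDl mulrDl; apply: le_trans (l2normD _ _) _.
by rewrite lerD ?l2norm_mulmx.
Qed.

Lemma norm2_opp m n (A : 'M[R]_(m, n)) : norm2 (- A) = norm2 A.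
Proof.
have h (B : 'M[R]_(m, n)) : norm2 (- B) <= norm2 B.
  by apply: norm2_le => [|x]; rewrite ?norm2_ge0// mulNmx l2normN l2norm_mulmx.
by apply/le_anti; rewrite h /= -{1}[A]opprK h.
Qed.

Lemma norm2M m n q (A : 'M[R]_(m, n)) (B : 'M[R]_(n, q)) :
  norm2 (A *m B) <= norm2 A * norm2 B.
Proof.
apply: norm2_le => [|x]; first by rewrite mulr_ge0 ?norm2_ge0.
rewrite -mulmxA -mulrA; apply: le_trans (l2norm_mulmx _ _) _.
by rewrite ler_wpM2l ?norm2_ge0 ?l2norm_mulmx.
Qed.

(** |A^T x|^2 is the inner product of x with A (A^T x), hence at most |x| |A| |A^T x|; cancel one
    factor. *)
Lemma norm2_tr_le m n (A : 'M[R]_(m, n)) : norm2 A^T <= norm2 A.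
Proof.
apply: norm2_le => [|x]; first exact: norm2_ge0.
have [->|N0] := eqVneq (l2norm (A^T *m x)) 0.
  by rewrite mulr_ge0 ?norm2_ge0 ?l2norm_ge0.
have gt0 : 0 < l2norm (A^T *m x) by rewrite lt_def N0 l2norm_ge0.
rewrite -(ler_pM2r gt0) -expr2 l2norm_sqr.
rewrite trmx_mul trmxK -mulmxA; apply: le_trans (ler_norm _) _.
apply: le_trans (dot_le _ _) _; rewrite [norm2 A * _]mulrC -mulrA.
by rewrite ler_wpM2l ?l2norm_ge0 ?l2norm_mulmx.
Qed.

Lemma norm2_tr m n (A : 'M[R]_(m, n)) : norm2 A^T = norm2 A.
Proof. by apply/le_anti; rewrite norm2_tr_le /= -{1}[A]trmxK norm2_tr_le. Qed.

Lemma entry_le_norm2 m n (A : 'M[R]_(m, n)) i j : `|A i j| <= norm2 A.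
Proof.
have := l2norm_mulmx A (delta_mx j 0); rewrite l2norm_delta mulr1.
apply: le_trans; rewrite -colE.
by have := coord_le_l2norm (col j A) i; rewrite mxE.
Qed.

Lemma norm2_le_entries m n (A : 'M[R]_(m, n)) b :
  (forall i j, `|A i j| <= b) -> norm2 A <= (m * n)%:R * b.
Proof.
move=> h; have hs : \sum_i \sum_j `|A i j| <= (m * n)%:R * b.
  have -> : (m * n)%:R * b = \sum_(i < m) \sum_(j < n) b.
    by rewrite !sumr_const !card_ord -mulrnA mulnC mulr_natl.
  by apply: ler_sum => i _; apply: ler_sum => j _.
apply: le_trans hs; apply: norm2_le => [|x]; last exact: l2norm_mulmx_entries.
by apply: sumr_ge0 => i _; apply: sumr_ge0 => j _.
Qed.

Lemma norm2_row_mx m n1 n2 (A : 'M[R]_(m, n1)) (B : 'M[R]_(m, n2)) :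
  norm2 (row_mx A B) <= norm2 A + norm2 B.
Proof.
apply: norm2_le => [|x]; first by rewrite addr_ge0 ?norm2_ge0.
rewrite -[x]vsubmxK mul_row_col mulrDl; apply: le_trans (l2normD _ _) _.
apply: lerD; apply: le_trans (l2norm_mulmx _ _) _; rewrite ler_wpM2l ?norm2_ge0 //.
  exact: l2norm_col_mxu.
exact: l2norm_col_mxd.
Qed.

Lemma norm2_col_mx m1 m2 n (A : 'M[R]_(m1, n)) (B : 'M[R]_(m2, n)) :
  norm2 (col_mx A B) <= norm2 A + norm2 B.
Proof.
by rewrite -norm2_tr tr_col_mx -(norm2_tr A) -(norm2_tr B) norm2_row_mx.
Qed.

Lemma norm2_lsub m n1 n2 (A : 'M[R]_(m, n1)) (B : 'M[R]_(m, n2)) :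
  norm2 A <= norm2 (row_mx A B).
Proof.
apply: norm2_le => [|x]; first exact: norm2_ge0.
have := l2norm_mulmx (row_mx A B) (col_mx x 0).
by rewrite mul_row_col mulmx0 addr0 l2norm_col_mx0.
Qed.

Lemma norm2_rsub m n1 n2 (A : 'M[R]_(m, n1)) (B : 'M[R]_(m, n2)) :
  norm2 B <= norm2 (row_mx A B).
Proof.
apply: norm2_le => [|x]; first exact: norm2_ge0.
have := l2norm_mulmx (row_mx A B) (col_mx 0 x).
by rewrite mul_row_col mulmx0 add0r l2norm_col_0mx.
Qed.

Lemma norm2_norows m n (A : 'M[R]_(m, n)) : m = 0%N -> norm2 A = 0.
Proof.
move=> m0; rewrite {}m0 in A *; apply/le_anti; rewrite norm2_ge0 andbT.
by have /(_ 0) := @norm2_le_entries _ _ A; rewrite mulr0; apply; case.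
Qed.

End Norm2.

(** * Lower bounds on |A x|, and matrices with nearly orthonormal columns *)

Section LowerBound.
Variable R : realType.

(** Stands for a <= sigma_min(A) without mentioning eigenvalues: it passes to perturbations and to
    subsets of columns by norm inequalities alone, and it makes sense for matrices without
    columns. *)
Definition lowerb m n (a : R) (A : 'M[R]_(m, n)) :=
  forall x : 'cV[R]_n, a * l2norm x <= l2norm (A *m x).

Lemma lowerb_add m n a b (A E : 'M[R]_(m, n)) :
  lowerb a A -> norm2 E <= b -> lowerb (a - b) (A + E).
Proof.
move=> hA hE x; rewrite mulmxDl mulrBl; apply: le_trans (l2norm_subl _ _).
apply: lerB => //; apply: le_trans (l2norm_mulmx _ _) _.
by rewrite ler_wpM2r ?l2norm_ge0.
Qed.

Lemma lowerb_le m n a b (A : 'M[R]_(m, n)) : b <= a -> lowerb a A -> lowerb b A.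
Proof.
by move=> ba hA x; apply: le_trans (hA x); rewrite ler_wpM2r ?l2norm_ge0.
Qed.

Lemma lowerb_lsub m n1 n2 a (A : 'M[R]_(m, n1)) (B : 'M[R]_(m, n2)) :
  lowerb a (row_mx A B) -> lowerb a A.
Proof.
move=> h x; have := h (col_mx x 0).
by rewrite mul_row_col mulmx0 addr0 l2norm_col_mx0.
Qed.

Lemma lowerb_rsub m n1 n2 a (A : 'M[R]_(m, n1)) (B : 'M[R]_(m, n2)) :
  lowerb a (row_mx A B) -> lowerb a B.
Proof.
move=> h x; have := h (col_mx 0 x).
by rewrite mul_row_col mulmx0 add0r l2norm_col_0mx.
Qed.

Lemma inj_unitmx n (A : 'M[R]_n) :
  (forall x : 'cV[R]_n, A *m x = 0 -> x = 0) -> A \in unitmx.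
Proof.
move=> h; rewrite -unitmx_tr -row_free_unit; apply: inj_row_free => v vA.
apply: (can_inj trmxK); rewrite trmx0; apply: h.
by apply: (can_inj trmxK); rewrite trmx_mul trmxK trmx0.
Qed.

Lemma lowerb_unitmx n a (A : 'M[R]_n) : 0 < a -> lowerb a A -> A \in unitmx.
Proof.
move=> a0 h; apply: inj_unitmx => x Ax0; apply: l2norm_eq0; apply/le_anti.
rewrite l2norm_ge0 andbT -(pmulr_rle0 _ a0).
by have := h x; rewrite Ax0 l2norm0.
Qed.

(** Write x = A z: then |B x| = |B A z| <= b |z| <= (b / a) |x|. This extracts Q^T U from Q^T U
    S. *)
Lemma norm2_cancel m n a b (B : 'M[R]_(m, n)) (A : 'M[R]_n) :
  0 < a -> lowerb a A -> norm2 (B *m A) <= b -> norm2 B <= b / a.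
Proof.
move=> a0 hA hBA; have uA := lowerb_unitmx a0 hA.
have b0 : 0 <= b by apply: le_trans hBA; exact: norm2_ge0.
apply: norm2_le => [|x]; first by rewrite divr_ge0 // ltW.
have -> : x = A *m (invmx A *m x) by rewrite mulKVmx.
move: (invmx A *m x) => z; rewrite mulmxA.
apply: le_trans (l2norm_mulmx _ _) _.
apply: (@le_trans _ _ (b * l2norm z)); first by rewrite ler_wpM2r ?l2norm_ge0.
by rewrite -mulrA ler_wpM2l // ler_pdivlMl.
Qed.

(** The difference |x|^2 - |Q x|^2 is the quadratic form of I - Q^T Q at x. *)
Lemma gram_bounds m n d (Q : 'M[R]_(m, n)) : norm2 (1%:M - Q^T *m Q) <= d ->
  forall x, (1 - d) * l2norm x ^+ 2 <= l2norm (Q *m x) ^+ 2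
            <= (1 + d) * l2norm x ^+ 2.
Proof.
move=> h x.
have E : l2norm x ^+ 2 - l2norm (Q *m x) ^+ 2
    = (x^T *m ((1%:M - Q^T *m Q) *m x)) 0 0.
  rewrite !l2norm_sqr mulmxBl mul1mx mulmxBr [RHS]mxE [X in _ = _ + X]mxE.
  by rewrite trmx_mul !mulmxA.
have : `|l2norm x ^+ 2 - l2norm (Q *m x) ^+ 2| <= d * l2norm x ^+ 2.
  rewrite E; apply: le_trans (dot_le _ _) _; rewrite mulrC expr2 mulrA.
  rewrite ler_wpM2r ?l2norm_ge0 //; apply: le_trans (l2norm_mulmx _ _) _.
  by rewrite ler_wpM2r ?l2norm_ge0.
rewrite ler_norml => /andP[h1 h2]; apply/andP; split; lra.
Qed.

(** Square roots are avoided here and in [gram_norm2] by (1 - d)^2 <= 1 - d and 1 + d <= (1 +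
    d)^2. *)
Lemma gram_lowerb m n d (Q : 'M[R]_(m, n)) : 0 <= d <= 1 ->
  norm2 (1%:M - Q^T *m Q) <= d -> lowerb (1 - d) Q.
Proof.
move=> /andP[d0 d1] h x; rewrite -(@ler_pXn2r _ 2) ?nnegrE ?l2norm_ge0 //.
  have /andP[+ _] := gram_bounds h x; apply: le_trans.
  rewrite exprMn ler_wpM2r ?sqr_ge0 // expr2 ler_piMr ?subr_ge0 //.
  by rewrite gerBl.
by rewrite mulr_ge0 ?l2norm_ge0 ?subr_ge0.
Qed.

Lemma gram_norm2 m n d (Q : 'M[R]_(m, n)) : 0 <= d ->
  norm2 (1%:M - Q^T *m Q) <= d -> norm2 Q <= 1 + d.
Proof.
move=> d0 h; apply: norm2_le => [|x]; first by lra.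
rewrite -(@ler_pXn2r _ 2) ?nnegrE ?l2norm_ge0 //.
  have /andP[_] := gram_bounds h x; move=> /le_trans; apply.
  by rewrite exprMn ler_wpM2r ?sqr_ge0 // expr2 ler_peMr; lra.
by rewrite mulr_ge0 ?l2norm_ge0 //; lra.
Qed.

(* [|x - Q Q^T x|^2 = |x|^2 - 2 |Q^T x|^2 + |Q Q^T x|^2], and the last term is
   at most [2 |Q^T x|^2]. *)
Lemma gram_proj_norm2 m n (Q : 'M[R]_(m, n)) :
  norm2 (1%:M - Q^T *m Q) <= 1 -> norm2 (1%:M - Q *m Q^T) <= 1.
Proof.
move=> h; apply: norm2_le => [|x]; first exact: ler01.
rewrite mul1r mulmxBl mul1mx -mulmxA; apply: l2norm_le_sqr.
rewrite l2norm_sqrD l2normN mulmxN [X in 2 * X]mxE mulmxA -[x^T *m Q]trmxK.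
rewrite trmx_mul trmxK -l2norm_sqr.
have /andP[_] := gram_bounds h (Q^T *m x); lra.
Qed.

End LowerBound.

(** * Extreme singular values and the condition number *)

Section ConditionNumber.
Variable R : realType.
Local Open Scope classical_set_scope.

(* With [y = M x], positivity of the form at [x - t y] bounds [|M x|^2] by a
   multiple of [x^T M x], so [M] cannot be invertible. *)
Lemma psd_singular n (M : 'M[R]_n) : M^T = M ->
  (forall x : 'cV[R]_n, 0 <= (x^T *m (M *m x)) 0 0) ->
  (forall e, 0 < e ->
     exists2 x : 'cV[R]_n, l2norm x = 1 & (x^T *m (M *m x)) 0 0 < e) ->
  M \notin unitmx.
Proof.
move=> Msym psd small; apply/negP => uM.
set mu := norm2 M + 1; have mu0 : 0 < mu by rewrite ltr_wpDl ?norm2_ge0.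
have h x : l2norm (M *m x) ^+ 2 <= mu * (x^T *m (M *m x)) 0 0.
  set y := M *m x.
  have := psd (x + (- mu^-1) *: y).
  have -> : ((x + (- mu^-1) *: y)^T *m (M *m (x + (- mu^-1) *: y))) 0 0 =
      (x^T *m y) 0 0 - 2 * mu^-1 * l2norm y ^+ 2
      + mu^-1 ^+ 2 * (y^T *m (M *m y)) 0 0.
    rewrite mulmxDr -scalemxAr -/y dotDl dotZl.
    rewrite !dotDr !dotZr -l2norm_sqr.
    have -> : (x^T *m (M *m y)) 0 0 = l2norm y ^+ 2.
      by rewrite mulmxA -{1}Msym -trmx_mul -/y -l2norm_sqr.
    ring.
  have q_le : (y^T *m (M *m y)) 0 0 <= mu * l2norm y ^+ 2.
    apply: le_trans (ler_norm _) _; apply: le_trans (dot_le _ _) _.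
    rewrite mulrC expr2 mulrA ler_wpM2r ?l2norm_ge0 //.
    apply: le_trans (l2norm_mulmx _ _) _.
    by rewrite ler_wpM2r ?l2norm_ge0 // lerDl.
  move: (x^T *m y) (y^T *m (M *m y)) (l2norm y ^+ 2) q_le => a b c q_le hp.
  have : mu^-1 ^+ 2 * b 0 0 <= mu^-1 * c.
    rewrite expr2 -mulrA ler_wpM2l ?invr_ge0 ?(ltW mu0) //.
    by rewrite ler_pdivrMl.
  by move=> h; rewrite -ler_pdivrMl //; lra.
(* A unit vector x satisfies 1 <= |M^-1|^2 |M x|^2 <= nu |M x|^2, which by [h] contradicts a form
   value below 1 / (nu mu). The summand 1 only ensures positivity. *)
set nu := norm2 (invmx M) ^+ 2 + 1; have nu0 : 0 < nu by rewrite ltr_wpDl ?sqr_ge0.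
have [|x x1 qx] := small (nu * mu)^-1; first by rewrite invr_gt0 mulr_gt0.
have: 1 < 1 :> R; last by rewrite ltxx.
apply: le_lt_trans (_ : nu * (mu * (x^T *m (M *m x)) 0 0) < 1); last first.
  by rewrite mulrA -ltr_pdivlMl ?mulr1 // mulr_gt0.
apply: le_trans (_ : 1 <= nu * l2norm (M *m x) ^+ 2) _; last first.
  by rewrite ler_wpM2l // ltW.
have := l2norm_mulmx (invmx M) (M *m x); rewrite mulKmx // x1 => h1.
apply: (@le_trans _ _ ((norm2 (invmx M) * l2norm (M *m x)) ^+ 2)).
  by rewrite exprn_ege1.
by rewrite exprMn ler_wpM2r ?sqr_ge0 // lerDl.
Qed.

Lemma eigenvalue_singular n (B : 'M[R]_n) a :
  B - a%:M \notin unitmx -> eigenvalue B a.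
Proof. by rewrite -row_free_unit -kermx_eq0. Qed.

Lemma gram_sym m n (A : 'M[R]_(m, n)) : (A^T *m A)^T = A^T *m A.
Proof. by rewrite trmx_mul trmxK. Qed.

Lemma gram_shift_form m n (A : 'M[R]_(m, n)) a (x : 'cV[R]_n) :
  (x^T *m ((A^T *m A - a%:M) *m x)) 0 0 = l2norm (A *m x) ^+ 2 - a * l2norm x ^+ 2.
Proof.
rewrite mulmxBl mul_scalar_mx (dotC x) dotDl -scaleNr dotZl -(dotC x).
by rewrite !l2norm_sqr trmx_mul !mulmxA mulNr.
Qed.

Lemma singular_valueP m n (A : 'M[R]_(m, n)) (sigma : R) : singular_values A sigma ->
  exists2 v : 'cV[R]_n, 0 < l2norm v & l2norm (A *m v) = sigma * l2norm v.
Proof.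
case=> s0 /eigenvalueP [v vA v0]; exists v^T.
  rewrite lt_def l2norm_ge0 andbT; apply: contra v0 => /eqP/l2norm_eq0 h.
  by rewrite -[v]trmxK h trmx0.
apply/eqP; rewrite -(@eqrXn2 _ 2) ?mulr_ge0 ?l2norm_ge0 //; apply/eqP.
rewrite exprMn !l2norm_sqr trmx_mul trmxK -mulmxA (mulmxA A^T) mulmxA vA.
by rewrite -scalemxAl mxE.
Qed.

(** The matrix |A|^2 I - A^T A is positive semidefinite, and by definition of the supremum its form
    is arbitrarily small on unit vectors, so it is singular. No maximizer, hence no compactness, is
    required. *)
Lemma norm2_singular_value m n (A : 'M[R]_(m, n.+1)) :
  singular_values A (norm2 A).
Proof.
split; first exact: norm2_ge0.
apply: eigenvalue_singular; set a := norm2 A ^+ 2.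
suff : - (A^T *m A - a%:M) \notin unitmx.
  by apply: contra => h; rewrite -scaleN1r unitmxZ ?unitrN1.
apply: psd_singular => [|x|e e0].
- by rewrite linearN /= linearB /= gram_sym tr_scalar_mx.
- rewrite mulNmx mulmxN mxE gram_shift_form oppr_ge0 subr_le0 -exprMn.
  by rewrite ler_pXn2r ?nnegrE ?mulr_ge0 ?norm2_ge0 ?l2norm_ge0 // l2norm_mulmx.
(* The form at x is (|A| - |A x|) (|A| + |A x|), whose second factor is below 2 |A| + 1. *)
have e'0 : 0 < e / (2 * norm2 A + 1).
  by rewrite divr_gt0 // ltr_wpDl // mulr_ge0 // norm2_ge0.
have [|_ [x /= x1 <-] hx] := sup_adherent e'0 (E := [set l2norm (A *m x) |
    x in [set x : 'cV[R]_n.+1 | l2norm x = 1]]).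
  split; last exact: norm2_has_ubound.
  by eexists; exists (delta_mx 0 0); rewrite /= ?l2norm_delta.
exists x => //; rewrite mulNmx mulmxN mxE gram_shift_form x1 expr1n mulr1.
have hu := l2norm_mulmx A x; rewrite x1 mulr1 in hu.
rewrite -/(norm2 A) in hx; rewrite opprB /a subr_sqr.
apply: le_lt_trans (_ : (norm2 A - l2norm (A *m x)) * (2 * norm2 A + 1) < _).
  by rewrite ler_wpM2l ?subr_ge0 //; lra.
rewrite -ltr_pdivlMr ?ltr_wpDl ?mulr_ge0 ?norm2_ge0 //; lra.
Qed.

Lemma singular_value_le_norm2 m n (A : 'M[R]_(m, n)) :
  ubound (singular_values A) (norm2 A).
Proof.
move=> s /singular_valueP [v v0 Av]; rewrite -(ler_pM2r v0) -Av.
exact: l2norm_mulmx.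
Qed.

Lemma sigma_maxE m n (A : 'M[R]_(m, n.+1)) : sigma_max A = norm2 A.
Proof.
apply/le_anti/andP; split.
  by apply: ge_sup; [exists (norm2 A); exact: norm2_singular_value|
                     exact: singular_value_le_norm2].
apply: ub_le_sup; last exact: norm2_singular_value.
by exists (norm2 A); exact: singular_value_le_norm2.
Qed.

(** The infimum of |A x| over unit vectors is the value wanted: A^T A minus its square times I is
    positive semidefinite with arbitrarily small form values. *)
Lemma lowerb_singular_value m n (A : 'M[R]_(m, n.+1)) :
  exists2 mu, lowerb mu A & singular_values A mu.
Proof.
pose E := [set l2norm (A *m x) | x in [set x : 'cV[R]_n.+1 | l2norm x = 1]].
have infE : has_inf E.
  split; first by eexists; exists (delta_mx 0 0); rewrite /= ?l2norm_delta.
  by exists 0 => _ [x _ <-]; exact: l2norm_ge0.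
have mu0 : 0 <= inf E.
  by apply: lb_le_inf infE.1 _ => _ [x _ <-]; exact: l2norm_ge0.
have low : lowerb (inf E) A.
  move=> x; have [x0|xN0] := eqVneq (l2norm x) 0.
    by rewrite x0 mulr0 l2norm_ge0.
  have x_gt0 : 0 < l2norm x by rewrite lt_def xN0 l2norm_ge0.
  rewrite -ler_pdivlMr // mulrC.
  rewrite -[X in _ <= X * _]ger0_norm ?invr_ge0 ?l2norm_ge0 // -l2normZ scalemxAr.
  apply: ge_inf infE.2 _ _.
  by exists ((l2norm x)^-1 *: x) => //=; exact: l2norm_normalize.
exists (inf E) => //; split => //; apply: eigenvalue_singular.
apply: psd_singular => [|x|e e0].
- by rewrite linearB /= gram_sym tr_scalar_mx.
- rewrite gram_shift_form subr_ge0 -exprMn.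
  by rewrite ler_pXn2r ?nnegrE ?mulr_ge0 ?l2norm_ge0.
(* The cap 1 bounds |A x| + inf E by 2 inf E + 2 in the factored difference of squares. *)
pose e' := Num.min 1 (e / (2 * inf E + 2)).
have e'0 : 0 < e'.
  rewrite /e' lt_min ltr01 divr_gt0 //; lra.
have [_ [x /= x1 <-] hx] := inf_adherent e'0 infE.
exists x => //; rewrite gram_shift_form x1 expr1n mulr1 subr_sqr.
have hu := low x; rewrite x1 mulr1 in hu.
have e'1 : e' <= 1 by rewrite ge_min lexx.
have e'2 : e' * (2 * inf E + 2) <= e.
  by rewrite -ler_pdivlMr ?ge_min ?lexx ?orbT //; lra.
apply: lt_le_trans e'2.
apply: le_lt_trans (_ : (l2norm (A *m x) - inf E) * (2 * inf E + 2) < _).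
  by rewrite ler_wpM2l ?subr_ge0 //; lra.
by rewrite ltr_pM2r; lra.
Qed.

Lemma lowerb_le_sigma_min m n a (A : 'M[R]_(m, n.+1)) :
  lowerb a A -> a <= sigma_min A.
Proof.
move=> h; apply: lb_le_inf => [|s /singular_valueP [v v0 Av]].
  by have [mu _] := lowerb_singular_value A; exists mu.
by rewrite -(ler_pM2r v0) -Av.
Qed.

Lemma lowerb_sigma_min m n (A : 'M[R]_(m, n.+1)) : lowerb (sigma_min A) A.
Proof.
have [mu low smu] := lowerb_singular_value A; apply: lowerb_le low.
by apply: ge_inf => //; exists 0 => s [].
Qed.

Lemma kappa_le m n a b t (A : 'M[R]_(m, n)) : (0 < n)%N -> 0 < a ->
  lowerb a A -> norm2 A <= b -> b <= t * a -> (kappa A <= t%:E)%E.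
Proof.
case: n A => // n A _ a0 low up bt; have sa := lowerb_le_sigma_min low.
rewrite /kappa gt_eqF ?(lt_le_trans a0) // lee_fin sigma_maxE.
have s0 := lt_le_trans a0 sa; rewrite ler_pdivrMr //.
have t0 : 0 <= t.
  by rewrite -(pmulr_lge0 _ a0); apply: le_trans bt; apply: le_trans up; exact: norm2_ge0.
by apply: le_trans up _; apply: le_trans bt _; rewrite ler_wpM2l.
Qed.

Lemma kappa_fin m n (A : 'M[R]_(m, n)) : (0 < n)%N -> kappa A != +oo%E ->
  exists2 sigma, 0 < sigma & lowerb sigma A /\ kappa A = (norm2 A / sigma)%:E.
Proof.
case: n A => // n A _; rewrite /kappa sigma_maxE.
have [//|sN0 _] := eqVneq (sigma_min A) 0.
exists (sigma_min A); last by split => //; exact: lowerb_sigma_min.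
rewrite lt_def sN0; apply: lowerb_le_sigma_min => x.
by rewrite mul0r l2norm_ge0.
Qed.

Lemma lowerb_le_norm2 m n a (A : 'M[R]_(m, n)) : (0 < n)%N ->
  lowerb a A -> a <= norm2 A.
Proof.
case: n A => // n A _ h; have := h (delta_mx 0 0).
have := l2norm_mulmx A (delta_mx 0 0); rewrite l2norm_delta !mulr1.
by move=> h1 h2; exact: le_trans h1.
Qed.

End ConditionNumber.

(** * Rounding errors of sums, products and entrywise operations *)

Section FloatingPointErrors.
Variables (R : realType) (u : R).

Lemma fl_sum_error s x : 0 <= u -> fl_sum u s x ->
  `|x - \sum_(y <- s) y| <= ((1 + u) ^+ size s - 1) * \sum_(y <- s) `|y|.
Proof.
move=> u_ge0; elim=> [|y|t s1 s2 x1 x2 y tE s1N s2N _ h1 _ h2 [d du ->]].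
- by rewrite !big_nil subrr normr0 mulr0.
- by rewrite !big_seq1 subrr normr0 expr1 addrAC subrr add0r mulr_ge0.
rewrite !(perm_big _ tE) !big_cat (perm_size tE) size_cat /=.
(* As the other part is nonempty, each part is strictly shorter than [s], so its bound holds with
   exponent one less than [size s]; the final rounding supplies the remaining factor 1 + u. *)
have {}h1 : `|x1 - \sum_(y <- s1) y| <=
    ((1 + u) ^+ (size s1 + size s2).-1 - 1) * \sum_(y <- s1) `|y|.
  apply: le_trans h1 _; rewrite ler_wpM2r ?sumr_ge0 // lerB // ler_weXn2l ?lerDl //.
  by case: (s2) s2N => // a l _; rewrite addnS leq_addr.
have {}h2 : `|x2 - \sum_(y <- s2) y| <=
    ((1 + u) ^+ (size s1 + size s2).-1 - 1) * \sum_(y <- s2) `|y|.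
  apply: le_trans h2 _; rewrite ler_wpM2r ?sumr_ge0 // lerB // ler_weXn2l ?lerDl //.
  by case: (s1) s1N => // a l _; rewrite addSn leq_addl.
have -> : (size s1 + size s2)%N = (size s1 + size s2).-1.+1.
  by case: (s1) s1N.
move: h1 h2; rewrite /= exprS; set g := (1 + u) ^+ _.
have a1 := ler_norm_sum s1 id xpredT; have a2 := ler_norm_sum s2 id xpredT.
move: a1 a2; rewrite /=.
set S1 := \sum_(y <- s1) y; set S2 := \sum_(y <- s2) y.
set N1 := \sum_(y <- s1) `|y|; set N2 := \sum_(y <- s2) `|y|.
move=> a1 a2 h1 h2.
have hx : `|x1 + x2| <= g * (N1 + N2).
  have -> : x1 + x2 = (x1 - S1) + (x2 - S2) + (S1 + S2) by ring.
  apply: le_trans (ler_normD _ _) _; have := ler_normD (x1 - S1) (x2 - S2).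
  have := ler_normD S1 S2; lra.
have -> : (x1 + x2) * (1 + d) - (S1 + S2) =
    (x1 - S1) + (x2 - S2) + d * (x1 + x2) by ring.
apply: le_trans (ler_normD _ _) _; have := ler_normD (x1 - S1) (x2 - S2).
have : `|d * (x1 + x2)| <= u * (g * (N1 + N2)).
  by rewrite normrM ler_pM.
lra.
Qed.

Lemma expr1D_sub1_le n : 0 <= u <= 1 -> (1 + u) ^+ n - 1 <= 2 ^+ n * u.
Proof.
move=> /andP[u_ge0 u_le1].
(* With 2 ^ n in place of 2 ^ n - 1 the induction would not close: each step adds a further u. *)
suff : (1 + u) ^+ n - 1 <= (2 ^+ n - 1) * u by lra.
elim: n => [|n IH]; first by rewrite !expr0 !subrr mul0r.
have : (1 + u) * ((1 + u) ^+ n - 1) <= 2 * ((1 + u) ^+ n - 1).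
  by rewrite ler_wpM2r ?subr_ge0 ?exprn_ege1 //; lra.
rewrite !exprS; lra.
Qed.

(* [2 ^+ n.+1 * u] bounds [(1 + u) ^+ n.+1 - 1] when [u <= 1]; the summand [1]
   makes the constant also cover a single entrywise rounding. *)
Definition fl_const (m n q : nat) : R :=
  (m * q)%:R * ((2 ^ n.+1 * n)%:R + 1).

Lemma fl_const_ge0 m n q : 0 <= fl_const m n q.
Proof. by rewrite mulr_ge0 ?addr_ge0. Qed.

Lemma fl_mulmx_error m n q (A : 'M[R]_(m, n)) (B : 'M[R]_(n, q)) C :
  0 <= u <= 1 -> fl_mulmx u A B C ->
  norm2 (C - A *m B) <= fl_const m n q * u * (norm2 A * norm2 B).
Proof.
move=> u01 h; have /andP[u_ge0 u_le1] := u01.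
rewrite /fl_const -!mulrA; apply: norm2_le_entries => i j.
rewrite mxE [X in _ + X]mxE [X in _ - X]mxE.
have [t ht /(fl_sum_error u_ge0)] := h i j.
rewrite size_map size_enum_ord !big_map -enumT !big_enum /=.
set N := \sum_l `|A i l * B l j|.
have N_le : N <= n%:R * (norm2 A * norm2 B).
  have -> : n%:R * (norm2 A * norm2 B) = \sum_(l < n) norm2 A * norm2 B.
    by rewrite sumr_const card_ord mulr_natl.
  by apply: ler_sum => l _; rewrite normrM ler_pM ?entry_le_norm2.
have N0 : 0 <= N by apply: sumr_ge0.
have ht1 : \sum_l `|t l| <= (1 + u) * N.
  rewrite mulr_sumr; apply: ler_sum => l _; have [d du ->] := ht l.
  rewrite normrM mulrC ler_wpM2r //; apply: le_trans (ler_normD _ _) _.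
  by rewrite normr1 lerD2l.
have ht2 : `|\sum_l t l - \sum_l A i l * B l j| <= u * N.
  rewrite -sumrB mulr_sumr; apply: le_trans (ler_norm_sum _ _ _) _.
  apply: ler_sum => l _; have [d du ->] := ht l.
  by rewrite mulrDr mulr1 addrAC subrr add0r normrM mulrC ler_wpM2r.
move=> h1.
(* The summation costs ((1 + u)^n - 1) (1 + u) N and the rounded products cost u N, which add up
   exactly to this. *)
have h2 : `|C i j - \sum_l A i l * B l j| <= ((1 + u) ^+ n.+1 - 1) * N.
  have -> : C i j - \sum_l A i l * B l j
    = (C i j - \sum_l t l) + (\sum_l t l - \sum_l A i l * B l j) by ring.
  apply: le_trans (ler_normD _ _) _; rewrite exprS.
  have : ((1 + u) ^+ n - 1) * (\sum_l `|t l|) <= ((1 + u) ^+ n - 1) * ((1 + u) * N).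
    by rewrite ler_wpM2l ?subr_ge0 ?exprn_ege1 //; lra.
  lra.
apply: le_trans h2 _.
apply: (@le_trans _ _ (2 ^+ n.+1 * u * (n%:R * (norm2 A * norm2 B)))).
  by rewrite ler_pM ?expr1D_sub1_le ?subr_ge0 ?exprn_ege1 //; lra.
rewrite natrM natrX.
have : 0 <= u * (norm2 A * norm2 B) by rewrite !mulr_ge0 ?norm2_ge0.
lra.
Qed.

(** The dimension [n] is free, so that an addition or subtraction following a product is charged
    with the constant of that product. *)
Lemma fl_entrywise_error m n q (A C : 'M[R]_(m, q)) :
  0 <= u -> (forall i j, fl u (A i j) (C i j)) ->
  norm2 (C - A) <= fl_const m n q * u * norm2 A.
Proof.
move=> u_ge0 h; rewrite /fl_const -!mulrA; apply: norm2_le_entries => i j.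
rewrite mxE [X in _ + X]mxE; have [d du ->] := h i j.
rewrite mulrDr mulr1 addrAC subrr add0r normrM mulrC.
apply: (@le_trans _ _ (u * norm2 A)); first by rewrite ler_pM ?entry_le_norm2.
by rewrite mulrDl mul1r lerDr !mulr_ge0 ?norm2_ge0.
Qed.

Lemma fl_addmx_error m n q (A B C : 'M[R]_(m, q)) : 0 <= u -> fl_addmx u A B C ->
  norm2 (C - (A + B)) <= fl_const m n q * u * norm2 (A + B).
Proof.
move=> u0 h; apply: fl_entrywise_error => // i j; rewrite mxE; exact: h.
Qed.

Lemma fl_submx_error m n q (A B C : 'M[R]_(m, q)) : 0 <= u -> fl_submx u A B C ->
  norm2 (C - (A - B)) <= fl_const m n q * u * norm2 (A - B).
Proof.
by move=> u0 h; apply: fl_entrywise_error => // i j; rewrite mxE [X in _ + X]mxE; exact: h.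
Qed.

End FloatingPointErrors.

(** * One projection, one factorization, and the residual of a block column *)

Section BlockStep.
Variable R : realType.

Lemma norm2D_le m n a b (A B : 'M[R]_(m, n)) :
  norm2 A <= a -> norm2 B <= b -> norm2 (A + B) <= a + b.
Proof. by move=> hA hB; apply: le_trans (norm2D _ _) _; exact: lerD. Qed.

Lemma norm2B_le m n a b (A B : 'M[R]_(m, n)) :
  norm2 A <= a -> norm2 B <= b -> norm2 (A - B) <= a + b.
Proof. by move=> hA hB; apply: norm2D_le; rewrite ?norm2_opp. Qed.

Lemma norm2M_le m n q a b (A : 'M[R]_(m, n)) (B : 'M[R]_(n, q)) :
  norm2 A <= a -> norm2 B <= b -> norm2 (A *m B) <= a * b.
Proof.
by move=> hA hB; apply: le_trans (norm2M _ _) _; rewrite ler_pM ?norm2_ge0.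
Qed.

Lemma norm2_near m n a b (A B : 'M[R]_(m, n)) :
  norm2 A <= a -> norm2 (B - A) <= b -> norm2 B <= a + b.
Proof. by move=> hA hB; rewrite -(subrK A B) addrC norm2D_le. Qed.

Lemma fl_mulmx_le m n q (u g a b : R) (A : 'M[R]_(m, n)) (B : 'M[R]_(n, q)) C :
  0 <= u <= 1 -> fl_const R m n q <= g -> norm2 A <= a -> norm2 B <= b ->
  fl_mulmx u A B C -> norm2 (C - A *m B) <= g * u * (a * b).
Proof.
move=> u01 hg hA hB h; have /andP[u0 _] := u01.
apply: le_trans (fl_mulmx_error u01 h) _.
by rewrite !ler_pM ?mulr_ge0 ?norm2_ge0 ?fl_const_ge0.
Qed.

(** Of the 3 a b, one comes from rounding the product and two from rounding the sum, whose computed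
    product has norm at most a b + g u a b <= 2 a b. *)
Lemma fl_addmul_le m n q (u g a b c : R) (Z : 'M[R]_(m, q))
    (A : 'M[R]_(m, n)) (B : 'M[R]_(n, q)) C :
  0 <= u <= 1 -> fl_const R m n q <= g -> 0 <= g -> g * u <= 1 ->
  norm2 Z <= c -> norm2 A <= a -> norm2 B <= b ->
  fl_addmul u Z A B C -> norm2 (C - (Z + A *m B)) <= g * u * (c + 3 * (a * b)).
Proof.
move=> u01 hg g0 gu1 hZ hA hB [P hP hC]; have /andP[u0 _] := u01.
have eP := fl_mulmx_le u01 hg hA hB hP.
have nP := norm2_near (norm2M_le hA hB) eP.
have eC : norm2 (C - (Z + P)) <= g * u * (c + (a * b + g * u * (a * b))).
  apply: le_trans (fl_addmx_error n u0 hC) _.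
  by rewrite !ler_pM ?mulr_ge0 ?norm2_ge0 ?fl_const_ge0 ?norm2D_le.
have -> : C - (Z + A *m B) = (C - (Z + P)) + (P - A *m B).
  by rewrite !opprD !addrA subrK.
apply: le_trans (norm2D_le eC eP) _.
have ab0 : 0 <= a * b.
  exact: mulr_ge0 (le_trans (norm2_ge0 A) hA) (le_trans (norm2_ge0 B) hB).
have gu0 : 0 <= g * u by rewrite mulr_ge0.
have : g * u * (g * u * (a * b)) <= g * u * (1 * (a * b)).
  by rewrite ler_wpM2l // ler_wpM2r.
lra.
Qed.

Lemma fl_submul_le m n q (u g a b c : R) (Z : 'M[R]_(m, q))
    (A : 'M[R]_(m, n)) (B : 'M[R]_(n, q)) C :
  0 <= u <= 1 -> fl_const R m n q <= g -> 0 <= g -> g * u <= 1 ->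
  norm2 Z <= c -> norm2 A <= a -> norm2 B <= b ->
  fl_submul u Z A B C -> norm2 (C - (Z - A *m B)) <= g * u * (c + 3 * (a * b)).
Proof.
move=> u01 hg g0 gu1 hZ hA hB [P hP hC]; have /andP[u0 _] := u01.
have eP := fl_mulmx_le u01 hg hA hB hP.
have nP := norm2_near (norm2M_le hA hB) eP.
have eC : norm2 (C - (Z - P)) <= g * u * (c + (a * b + g * u * (a * b))).
  apply: le_trans (fl_submx_error n u0 hC) _.
  by rewrite !ler_pM ?mulr_ge0 ?norm2_ge0 ?fl_const_ge0 ?norm2B_le.
have -> : C - (Z - A *m B) = (C - (Z - P)) - (P - A *m B).
  by move: (A *m B) => AB; apply/matrixP => i j; rewrite !mxE; ring.
apply: le_trans (norm2B_le eC eP) _.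
have ab0 : 0 <= a * b.
  exact: mulr_ge0 (le_trans (norm2_ge0 A) hA) (le_trans (norm2_ge0 B) hB).
have gu0 : 0 <= g * u by rewrite mulr_ge0.
have : g * u * (g * u * (a * b)) <= g * u * (1 * (a * b)).
  by rewrite ler_wpM2l // ler_wpM2r.
lra.
Qed.

(* Since [Q^T Q = I + O(u)], one projection leaves
   [Q^T W = (I - Q^T Q) Q^T Z + O(u) = O(u)]. *)
Lemma project_out_error m n s (u g d nu : R) (Q : 'M[R]_(m, n))
    (Z W : 'M[R]_(m, s)) (S : 'M[R]_(n, s)) :
  0 <= u <= 1 -> 0 <= g -> g * u <= 1 ->
  fl_const R n m s <= g -> fl_const R m n s <= g ->
  norm2 (1%:M - Q^T *m Q) <= d -> d <= 1 -> norm2 Z <= nu ->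
  fl_mulmx u Q^T Z S -> fl_submul u Z Q S W ->
  [/\ norm2 S <= 4 * nu,
      exists2 E, W = Z - Q *m S + E & norm2 E <= 25 * g * u * nu,
      norm2 (S - Q^T *m Z) <= 2 * g * u * nu,
      norm2 W <= (1 + 29 * g * u) * nu &
      norm2 (Q^T *m W) <= (2 * d + 58 * g * u) * nu].
Proof.
move=> u01 g0 gu1 hg1 hg2 hQ d1 hZ hS hW.
have d0 : 0 <= d := le_trans (norm2_ge0 _) hQ.
have nu0 : 0 <= nu := le_trans (norm2_ge0 _) hZ.
have Q2 : norm2 Q <= 2 by apply: le_trans (gram_norm2 d0 hQ) _; lra.
have QT2 : norm2 Q^T <= 2 by rewrite norm2_tr.
have gunu : g * u * nu <= nu by rewrite ler_piMl.
have eS : norm2 (S - Q^T *m Z) <= 2 * g * u * nu.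
  by apply: le_trans (fl_mulmx_le u01 hg1 QT2 hZ hS) _; lra.
have nS : norm2 S <= 4 * nu.
  by apply: le_trans (norm2_near (norm2M_le QT2 hZ) eS) _; lra.
have := fl_submul_le u01 hg2 g0 gu1 hZ Q2 nS hW.
set E := W - _ => hE.
(* 25 = 1 + 3 (2 * 4), from |Q| <= 2 and |S| <= 4 nu. Adding |Q F| <= 4 g u nu gives 29, and one
   more factor |Q^T| <= 2 gives 58. *)
have {}hE : norm2 E <= 25 * g * u * nu by apply: le_trans hE _; lra.
have WE : W = Z - Q *m S + E by rewrite addrC subrK.
have eF := eS; set F := S - Q^T *m Z in eF.
have SE : S = Q^T *m Z + F by rewrite addrC subrK.
clearbody E F; split => //; first by exists E.
  have -> : W = (1%:M - Q *m Q^T) *m Z - Q *m F + E.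
    by rewrite WE SE mulmxBl mul1mx mulmxDr opprD addrA mulmxA.
  (* The bound 1, rather than some larger constant, keeps |W| <= (1 + O(u)) nu, so that kappa W
     barely exceeds nu / sigma. *)
  have P1 := gram_proj_norm2 (le_trans hQ d1).
  apply: le_trans (norm2D_le (norm2B_le (norm2M_le P1 hZ) (norm2M_le Q2 eF)) hE) _.
  lra.
have -> : Q^T *m W = (1%:M - Q^T *m Q) *m (Q^T *m Z) - Q^T *m (Q *m F) + Q^T *m E.
  by rewrite WE SE mulmxBl mul1mx !mulmxDr mulmxN mulmxDr opprD !mulmxA addrA.
apply: le_trans (norm2D_le (norm2B_le (norm2M_le hQ (norm2M_le QT2 hZ))
  (norm2M_le QT2 (norm2M_le Q2 eF))) (norm2M_le QT2 hE)) _.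
lra.
Qed.

(** From |U| <= 2 one gets |S y| >= |U S y| / 2 >= (l - d) |y| / 2 >= (l / 4) |y|, and from |U z| >=
    |z| / 2 the upper bound on S. Since Q^T U S = Q^T (W + dW), [norm2_cancel] bounds Q^T U. Both
    passes use this, with l = sigma / 2 and l = 1 / 2. *)
Lemma io_factor_bounds m n s (l w d a : R) (Q : 'M[R]_(m, n))
    (W dW U : 'M[R]_(m, s)) (S : 'M[R]_s) :
  W + dW = U *m S -> 0 < l -> lowerb l W -> norm2 W <= w -> norm2 dW <= d ->
  2 * d <= l -> norm2 (1%:M - U^T *m U) <= 2^-1 ->
  norm2 Q <= 2 -> norm2 (Q^T *m W) <= a ->
  [/\ norm2 U <= 2, norm2 S <= 2 * (w + d), lowerb (l / 4) S &
      norm2 (Q^T *m U) <= (a + 2 * d) / (l / 4)].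
Proof.
move=> E l0 lowW hW hd dl hU Q2 QW.
have d0 : 0 <= d := le_trans (norm2_ge0 _) hd.
have w0 : 0 <= w := le_trans (norm2_ge0 _) hW.
have U2 : norm2 U <= 2 by apply: le_trans (gram_norm2 _ hU) _; lra.
have lowU : lowerb (1 - 2^-1) U by apply: gram_lowerb hU; lra.
have lowS : lowerb (l / 4) S.
  move=> y; have := lowerb_add lowW hd y; rewrite E -mulmxA => h1.
  have h2 : l2norm (U *m (S *m y)) <= 2 * l2norm (S *m y).
    apply: le_trans (l2norm_mulmx _ _) _.
    by rewrite ler_wpM2r ?l2norm_ge0.
  have h3 : 2 * d * l2norm y <= l * l2norm y by rewrite ler_wpM2r ?l2norm_ge0.
  lra.
split => //.
  apply: norm2_le => [|y]; first lra.
  have h1 := lowU (S *m y); rewrite mulmxA -E in h1.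
  have h2 := l2norm_mulmx (W + dW) y.
  have h3 : norm2 (W + dW) * l2norm y <= (w + d) * l2norm y.
    by rewrite ler_wpM2r ?l2norm_ge0 ?norm2D_le.
  lra.
apply: norm2_cancel lowS _; first by rewrite divr_gt0.
rewrite -mulmxA -E mulmxDr; apply: norm2D_le => //.
by apply: norm2M_le; rewrite ?norm2_tr.
Qed.

(* [(x - Q S + E) y = [X + dX, x + E] [-z; y]] with [z] solving [Rm z = S y]. *)
Lemma lowerb_projected m n s (sigma a b : R) (X dX Q : 'M[R]_(m, n))
    (x E : 'M[R]_(m, s)) (Rm : 'M[R]_n) (S : 'M[R]_(n, s)) :
  lowerb sigma (row_mx X x) -> X + dX = Q *m Rm ->
  norm2 dX <= a -> norm2 E <= b -> a + b < sigma ->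
  lowerb (sigma - (a + b)) (x - Q *m S + E).
Proof.
move=> low XQ hdX hE lt.
have b0 : 0 <= b := le_trans (norm2_ge0 _) hE.
(* The lower bound sigma - a > 0 for X + dX = Q Rm already makes Rm injective. *)
have uR : Rm \in unitmx.
  apply: inj_unitmx => v Rv; have := lowerb_add (lowerb_lsub low) hdX v.
  rewrite XQ -mulmxA Rv mulmx0 l2norm0 pmulr_rle0; last by lra.
  by move=> v0; apply: l2norm_eq0; apply/le_anti; rewrite v0 l2norm_ge0.
move=> y; set z := invmx Rm *m (S *m y).
have hD : norm2 (row_mx dX E) <= a + b.
  by apply: le_trans (norm2_row_mx _ _) _; exact: lerD.
have := lowerb_add low hD (col_mx (- z) y).
rewrite add_row_mx XQ mul_row_col mulmxN -mulmxA mulKVmx //.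
have -> : - (Q *m (S *m y)) + (x + E) *m y = (x - Q *m S + E) *m y.
  by rewrite !mulmxDl mulNmx -mulmxA addrCA addrA.
apply: le_trans; rewrite ler_wpM2l ?l2norm_col_mxd //; lra.
Qed.

Lemma gram_row_mx m n s (a b c : R) (Q : 'M[R]_(m, n)) (q : 'M[R]_(m, s)) :
  norm2 (1%:M - Q^T *m Q) <= a -> norm2 (Q^T *m q) <= b ->
  norm2 (1%:M - q^T *m q) <= c ->
  norm2 (1%:M - (row_mx Q q)^T *m row_mx Q q) <= a + 2 * b + c.
Proof.
move=> ha hb hc.
rewrite tr_row_mx mul_col_row scalar_mx_block opp_block_mx add_block_mx !add0r.
rewrite block_mxEv; apply: le_trans (norm2_col_mx _ _) _.
have h1 := norm2_row_mx (1%:M - Q^T *m Q) (- (Q^T *m q)).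
have h2 := norm2_row_mx (- (q^T *m Q)) (1%:M - q^T *m q).
have h3 : norm2 (q^T *m Q) <= b by rewrite -norm2_tr trmx_mul trmxK.
rewrite !norm2_opp in h1 h2; lra.
Qed.

(** Eliminating W, U and V leaves the local errors only. Those of the second pass appear multiplied
    by Sk, hence become relative to nu. *)
Lemma residual_expansion m n s (x W dW U V dV q E1 E2 : 'M[R]_(m, s))
    (Q : 'M[R]_(m, n)) (S T R1 F1 : 'M[R]_(n, s)) (Sk Tk Rk F2 : 'M[R]_s) :
  W = x - Q *m S + E1 -> W + dW = U *m Sk ->
  V = U - Q *m T + E2 -> V + dV = q *m Tk ->
  R1 = S + T *m Sk + F1 -> Rk = Tk *m Sk + F2 ->
  x + (E1 + dW + (E2 + dV) *m Sk + Q *m F1 + q *m F2) = Q *m R1 + q *m Rk.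
Proof.
move=> hW hdW hV hdV -> ->.
have eS : Q *m S = x + E1 - W.
  by rewrite hW; move: (Q *m S) => QS; apply/matrixP => i j; rewrite !mxE; ring.
have eT : Q *m T *m Sk = U *m Sk + E2 *m Sk - V *m Sk.
  rewrite -mulmxDl -mulmxBl hV; congr (_ *m _).
  by move: (Q *m T) => QT; apply/matrixP => i j; rewrite !mxE; ring.
rewrite !mulmxDr !mulmxA -hdV eS eT -hdW !mulmxDl.
move: (V *m Sk) (dV *m Sk) (E2 *m Sk) (Q *m F1) (q *m F2) => a b c d e.
by apply/matrixP => i j; rewrite !mxE; ring.
Qed.

End BlockStep.

(** * The two passes for one block column, with explicit constants *)

Section BlockColumn.
Variable R : realType.

(** The power of the condition number is absorbed into the fixed number [b], so the passes need no
    exponents. *)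
Definition io_bounds m s (IO : io_routine R m s) (t r b : R) : Prop :=
  forall Y : 'M[R]_(m, s), (kappa Y <= t%:E)%E ->
    io_residual_le IO r Y /\ norm2 (1%:M - (IO Y).1^T *m (IO Y).1) <= b.

Lemma kappa_ratio_le m s (t a b : R) (A : 'M[R]_(m, s)) : (0 < s)%N ->
  0 < a -> 0 <= t <= 2^-1 -> lowerb ((1 - t) * a) A -> norm2 A <= (1 + t) * b ->
  a <= b -> (kappa A <= ((1 + 4 * t) * (b / a))%:E)%E.
Proof.
move=> s0 a0 /andP[t0 t1] low up ab.
apply: kappa_le s0 _ low up _; first by rewrite mulr_gt0 //; lra.
have -> : (1 + 4 * t) * (b / a) * ((1 - t) * a) = (1 + 4 * t) * (1 - t) * b.
  by field; rewrite gt_eqF.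
rewrite ler_wpM2r //; first by rewrite (le_trans _ ab) ?ltW.
(* This is (1 + t) / (1 - t) <= 1 + 4 t, because (1 + 4 t) (1 - t) - (1 + t) = 2 t (1 - 2 t). *)
have : 0 <= t * (1 - 2 * t) by rewrite mulr_ge0 //; lra.
lra.
Qed.

Lemma first_pass m n s (u g w r rho c h t sigma nu : R) (IO : io_routine R m s)
    (X dX Q : 'M[R]_(m, n)) (x W U : 'M[R]_(m, s)) (Rm : 'M[R]_n)
    (S : 'M[R]_(n, s)) (Sk : 'M[R]_s) :
  (0 < s)%N -> [/\ 0 <= g, 0 <= w, 0 <= r & 0 <= rho] ->
  0 <= u <= 1 -> 0 < sigma <= nu -> u <= h -> u * nu <= h * sigma ->
  fl_const R n m s <= g -> fl_const R m n s <= g ->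
  [/\ g * h <= 1, w * h <= 1, (r + 29 * g) * h <= 4^-1,
      rho * h <= 16^-1 & c * h <= 4^-1] ->
  4 * (r + 29 * g) * h <= t ->
  io_bounds IO ((1 + t) * (nu / sigma)) (rho * u) (c * h) ->
  lowerb sigma (row_mx X x) -> norm2 x <= nu ->
  X + dX = Q *m Rm -> norm2 dX <= r * u * nu ->
  norm2 (1%:M - Q^T *m Q) <= w * u ->
  fl_mulmx u Q^T x S -> fl_submul u x Q S W -> IO W = (U, Sk) ->
  [/\ exists2 E, W = x - Q *m S + E & norm2 E <= 25 * g * u * nu,
      exists2 dW, W + dW = U *m Sk & norm2 dW <= 2 * rho * u * nu,
      norm2 (1%:M - U^T *m U) <= c * h,
      norm2 S <= 4 * nu /\ norm2 Sk <= 8 * nu &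
      norm2 (Q^T *m U) <= 8 * (2 * w + 58 * g + 4 * rho) * h].
Proof.
move=> s0 [g0 w0 r0 rho0] u01 /andP[sig0 signu] uh unu hg1 hg2.
move=> [gh wh rgh rhoh ch] ht hIO low hx XQ hdX hQ fS fW eIO.
have /andP[u0 u1] := u01.
have nu0 : 0 <= nu by rewrite (le_trans _ signu) ?ltW.
have gu : g * u <= g * h by rewrite ler_wpM2l.
have wu : w * u <= w * h by rewrite ler_wpM2l.
have rhou : rho * u <= rho * h by rewrite ler_wpM2l.
have Q2 : norm2 Q <= 2.
  by apply: le_trans (gram_norm2 (mulr_ge0 w0 u0) hQ) _; clear -wu wh; lra.
have [nS EW _ nW QW] := project_out_error u01 g0 (le_trans gu gh) hg1 hg2 hQ
  (le_trans wu wh) hx fS fW.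
(* One [t1] serves both sides: the lower bound drops by (r + 25 g) u nu <= t1 sigma, and the norm
   grows by the factor 1 + 29 g u <= 1 + t1. *)
set t1 := (r + 29 * g) * h in rgh.
have gh0 : 0 <= g * h by rewrite mulr_ge0 // (le_trans u0).
have rh0 : 0 <= r * h by rewrite mulr_ge0 // (le_trans u0).
have t10 : 0 <= t1 by rewrite /t1 mulrDl addr_ge0 // -mulrA mulr_ge0.
have t1sig : t1 * sigma <= 4^-1 * sigma by rewrite ler_wpM2r // ltW.
have lowW : lowerb ((1 - t1) * sigma) W.
  have [E WE hE] := EW.
  have ab : r * u * nu + 25 * g * u * nu <= t1 * sigma.
    have h1 : (r + 25 * g) * (u * nu) <= (r + 25 * g) * (h * sigma).
      by rewrite ler_wpM2l // addr_ge0 // mulr_ge0.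
    have h2 : 0 <= g * h * sigma by rewrite mulr_ge0 // ltW.
    by rewrite /t1; clear -h1 h2; lra.
  have ab1 : r * u * nu + 25 * g * u * nu < sigma by clear -ab t1sig sig0; lra.
  rewrite WE; apply: lowerb_le (lowerb_projected S low XQ hdX hE ab1).
  by clear -ab; lra.
have nW1 : norm2 W <= (1 + t1) * nu.
  apply: le_trans nW _; rewrite ler_wpM2r // /t1.
  by clear -gu rh0; lra.
have kW : (kappa W <= ((1 + t) * (nu / sigma))%:E)%E.
  have t12 : 0 <= t1 <= 2^-1 by clear -t10 rgh; lra.
  apply: le_trans (kappa_ratio_le s0 sig0 t12 lowW nW1 signu) _.
  by rewrite lee_fin ler_wpM2r ?(divr_ge0 nu0 (ltW sig0)) // lerD2l /t1 mulrA.
have [] := hIO _ kW; rewrite /io_residual_le eIO /= => -[dW hW ndW] hU.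
have lowW2 : lowerb (sigma / 2) W.
  by apply: lowerb_le lowW; clear -t1sig sig0; lra.
have nW2 : norm2 W <= 2 * nu.
  by apply: le_trans nW1 _; rewrite ler_wpM2r //; clear -rgh; lra.
have {}ndW : norm2 dW <= 2 * rho * u * nu.
  apply: le_trans ndW _.
  have : rho * u * norm2 W <= rho * u * (2 * nu) by rewrite ler_wpM2l ?mulr_ge0.
  by clear; lra.
have dWl : 2 * (2 * rho * u * nu) <= sigma / 2.
  have h1 : rho * (u * nu) <= rho * (h * sigma) by rewrite ler_wpM2l.
  have h2 : rho * h * sigma <= 16^-1 * sigma by rewrite ler_wpM2r // ltW.
  by clear -h1 h2 sig0; lra.
have sig20 : 0 < sigma / 2 by rewrite divr_gt0.
have hU2 : norm2 (1%:M - U^T *m U) <= 2^-1.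
  by apply: le_trans hU _; clear -ch; lra.
have [_ nSk _ QU] := io_factor_bounds hW sig20 lowW2 nW2 ndW dWl hU2 Q2 QW.
split => //; first by exists dW.
  split=> //; apply: le_trans nSk _.
  have h1 : rho * u * nu <= 16^-1 * nu by rewrite ler_wpM2r // (le_trans rhou).
  by clear -h1 nu0; lra.
(* Division by l / 4 = sigma / 8 gives the factor 8 and turns u nu / sigma into h. *)
apply: le_trans QU _; rewrite ler_pdivrMr; last by rewrite divr_gt0.
have h1 : (2 * w + 58 * g + 4 * rho) * (u * nu) <=
    (2 * w + 58 * g + 4 * rho) * (h * sigma).
  by rewrite ler_wpM2l // !addr_ge0 // mulr_ge0.
by clear -h1; lra.
Qed.

Lemma second_pass m n s (u g w rho c c' a h t : R) (IO : io_routine R m s)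
    (Q : 'M[R]_(m, n)) (U V q : 'M[R]_(m, s)) (T : 'M[R]_(n, s)) (Tk : 'M[R]_s) :
  (0 < s)%N -> [/\ 0 <= g, 0 <= w, 0 <= rho, 0 <= c & 0 <= a] ->
  0 <= u <= 1 -> u <= h ->
  fl_const R n m s <= g -> fl_const R m n s <= g ->
  [/\ g * h <= 1, w * h <= 1, (c + (2 * a + 58 * g)) * h <= 4^-1,
      rho * h <= 8^-1 & c' * u <= 2^-1] ->
  4 * (c + (2 * a + 58 * g)) * h <= t ->
  io_bounds IO (1 + t) (rho * u) (c' * u) ->
  norm2 (1%:M - Q^T *m Q) <= w * u ->
  norm2 (1%:M - U^T *m U) <= c * h -> norm2 (Q^T *m U) <= a * h ->
  fl_mulmx u Q^T U T -> fl_submul u U Q T V -> IO V = (q, Tk) ->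
  [/\ exists2 E, V = U - Q *m T + E & norm2 E <= 50 * g * u,
      exists2 dV, V + dV = q *m Tk & norm2 dV <= 2 * rho * u,
      norm2 (1%:M - q^T *m q) <= c' * u,
      [/\ norm2 T <= 8, norm2 q <= 2 & norm2 Tk <= 8] &
      norm2 (Q^T *m q) <= 8 * (4 * w + 116 * g + 4 * rho) * u].
Proof.
move=> s0 [g0 w0 rho0 c0 a0] u01 uh hg1 hg2.
move=> [gh wh cgh rhoh cu] ht hIO hQ hU QU fT fV eIO.
have /andP[u0 u1] := u01; have h0 := le_trans u0 uh.
have gu : g * u <= g * h by rewrite ler_wpM2l.
have wu : w * u <= w * h by rewrite ler_wpM2l.
have rhou : rho * u <= rho * h by rewrite ler_wpM2l.
have Q2 : norm2 Q <= 2.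
  by apply: le_trans (gram_norm2 (mulr_ge0 w0 u0) hQ) _; clear -wu wh; lra.
have ch0 : 0 <= c * h by rewrite mulr_ge0.
have ah0 : 0 <= a * h by rewrite mulr_ge0.
have gh0 : 0 <= g * h by rewrite mulr_ge0.
have ch1 : 0 <= c * h <= 1 by clear -ch0 ah0 gh0 cgh; lra.
have U2 : norm2 U <= 2.
  by apply: le_trans (gram_norm2 ch0 hU) _; clear -ch1; lra.
have [nT [E VE hE] eT _ QV] := project_out_error u01 g0 (le_trans gu gh) hg1 hg2
  hQ (le_trans wu wh) U2 fT fV.
set t2 := (c + (2 * a + 58 * g)) * h in cgh.
have t20 : 0 <= t2 by rewrite /t2; clear -ch0 ah0 gh0; lra.
(* T is close to Q^T U, hence small itself. The constant is 58 = 50 + 2 * 4, from E and from |Q|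
   times the rounding error of T. *)
have hD : norm2 (E - Q *m T) <= (2 * a + 58 * g) * h.
  have nT' : norm2 T <= a * h + 2 * g * u * 2 by exact: norm2_near QU eT.
  apply: le_trans (norm2B_le hE (norm2M_le Q2 nT')) _.
  by clear -gu; lra.
have VUD : V = U + (E - Q *m T) by rewrite VE addrA addrAC.
have lowV : lowerb ((1 - t2) * 1) V.
  rewrite VUD; apply: lowerb_le (lowerb_add (gram_lowerb ch1 hU) hD).
  by rewrite /t2; clear; lra.
have nV1 : norm2 V <= (1 + t2) * 1.
  rewrite VUD; apply: le_trans (norm2D_le (gram_norm2 ch0 hU) hD) _.
  by rewrite /t2; clear; lra.
have kV : (kappa V <= (1 + t)%:E)%E.
  have t22 : 0 <= t2 <= 2^-1 by clear -cgh t20; lra.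
  apply: le_trans (kappa_ratio_le s0 ltr01 t22 lowV nV1 (lexx 1)) _.
  by rewrite lee_fin divr1 mulr1 lerD2l /t2 mulrA.
have [] := hIO _ kV; rewrite /io_residual_le eIO /= => -[dV hV ndV] hq.
have lowV2 : lowerb (2^-1) V by apply: lowerb_le lowV; clear -cgh; lra.
have nV2 : norm2 V <= 2 by apply: le_trans nV1 _; clear -cgh; lra.
have {}ndV : norm2 dV <= 2 * rho * u.
  apply: le_trans ndV _.
  have h1 : rho * u * norm2 V <= rho * u * 2 by rewrite ler_wpM2l ?mulr_ge0.
  by clear -h1; lra.
have dVl : 2 * (2 * rho * u) <= 2^-1 by clear -rhou rhoh; lra.
have half0 : 0 < 2^-1 :> R by rewrite invr_gt0.
have [q2 nTk _ Qq] :=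
  io_factor_bounds hV half0 lowV2 nV2 ndV dVl (le_trans hq cu) Q2 QV.
split => //; first by exists E => //; apply: le_trans hE _; clear; lra.
- by exists dV.
- split=> //; first by apply: le_trans nT _; clear; lra.
  by apply: le_trans nTk _; clear -dVl; lra.
(* Here l / 4 is the number 1 / 8, so the bound stays of order u. *)
by apply: le_trans Qq _; rewrite ler_pdivrMr ?divr_gt0 //; clear; lra.
Qed.

Lemma block_column_step m n s (u g w r rho1 rho2 c1 c2 C h sigma nu : R)
    (IO1 IO2 : io_routine R m s)
    (X dX Q : 'M[R]_(m, n)) (x W U V q : 'M[R]_(m, s)) (Rm : 'M[R]_n)
    (S T R1 : 'M[R]_(n, s)) (Sk Tk Rk : 'M[R]_s) :
  (0 < s)%N ->
  [/\ 0 <= g, 0 <= w & 0 <= r] -> [/\ 0 <= rho1, 0 <= rho2, 0 <= c1 & 0 <= c2] ->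
  0 <= u <= 1 -> 0 < sigma <= nu -> u <= h -> u * nu <= h * sigma ->
  [/\ fl_const R n m s <= g, fl_const R m n s <= g,
      fl_const R n s s <= g & fl_const R s s s <= g] ->
  C * h <= 1 ->
  g + w + 4 * (r + 29 * g) + 16 * rho1 + 8 * rho2 + 2 * c2
    + 4 * (c1 + (16 * (2 * w + 58 * g + 4 * rho1) + 58 * g)) <= C ->
  io_bounds IO1 ((1 + C * h) * (nu / sigma)) (rho1 * u) (c1 * h) ->
  io_bounds IO2 (1 + C * h) (rho2 * u) (c2 * u) ->
  lowerb sigma (row_mx X x) -> norm2 x <= nu ->
  X + dX = Q *m Rm -> norm2 dX <= r * u * nu ->
  norm2 (1%:M - Q^T *m Q) <= w * u ->
  fl_mulmx u Q^T x S -> fl_submul u x Q S W -> IO1 W = (U, Sk) ->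
  fl_mulmx u Q^T U T -> fl_submul u U Q T V -> IO2 V = (q, Tk) ->
  fl_addmul u S T Sk R1 -> fl_mulmx u Tk Sk Rk ->
  [/\ exists2 dx, x + dx = Q *m R1 + q *m Rk &
        norm2 dx <= (2000 * g + 2 * rho1 + 16 * rho2) * u * nu,
      norm2 (Q^T *m q) <= 8 * (4 * w + 116 * g + 4 * rho2) * u &
      norm2 (1%:M - q^T *m q) <= c2 * u].
Proof.
move=> s0 [g0 w0 r0] [rho10 rho20 c10 c20] u01 sigma_nu uh unu
  [hg1 hg2 hg3 hg4] Ch hC hIO1 hIO2 low hx XQ hdX hQ fS fW eIO1 fT fV eIO2 fR1 fRk.
have /andP[u0 _] := u01; have h0 := le_trans u0 uh.
(* Each summand in the lower bound on [C] encodes one smallness condition of the passes, multiplied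
   by the reciprocal of its threshold. *)
have small b : b <= C -> b * h <= 1.
  by move=> bC; apply: le_trans Ch; rewrite ler_wpM2r.
have gh : g * h <= 1 by apply: small; clear -hC g0 w0 r0 rho10 rho20 c10 c20; lra.
have wh : w * h <= 1 by apply: small; clear -hC g0 w0 r0 rho10 rho20 c10 c20; lra.
have rgC : 4 * (r + 29 * g) <= C by clear -hC g0 w0 r0 rho10 rho20 c10 c20; lra.
have cgC : 4 * (c1 + (16 * (2 * w + 58 * g + 4 * rho1) + 58 * g)) <= C.
  by clear -hC g0 w0 r0 rho10 rho20 c10 c20; lra.
have rho1h : 16 * rho1 * h <= 1.
  by apply: small; clear -hC g0 w0 r0 rho10 rho20 c10 c20; lra.
have rho2h : 8 * rho2 * h <= 1.
  by apply: small; clear -hC g0 w0 r0 rho10 rho20 c10 c20; lra.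
have c2h : 2 * c2 * h <= 1.
  by apply: small; clear -hC g0 w0 r0 rho10 rho20 c10 c20; lra.
have c1h : 4 * c1 * h <= 1.
  by apply: small; clear -cgC g0 w0 rho10; lra.
have rgh := small _ rgC; have cgh := small _ cgC.
have c2u : c2 * u <= c2 * h by rewrite ler_wpM2l.
have conds1 : [/\ g * h <= 1, w * h <= 1, (r + 29 * g) * h <= 4^-1,
    rho1 * h <= 16^-1 & c1 * h <= 4^-1].
  by split => //; [clear -rgh|clear -rho1h|clear -c1h]; lra.
have [[E1 WE hE1] [dW hW ndW] hU [nS nSk] QU] := first_pass s0
  (And4 g0 w0 r0 rho10) u01 sigma_nu uh unu hg1 hg2 conds1 (ler_wpM2r h0 rgC)
  hIO1 low hx XQ hdX hQ fS fW eIO1.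
set a := 8 * (2 * w + 58 * g + 4 * rho1) in QU.
have a0 : 0 <= a by rewrite /a; clear -w0 g0 rho10; lra.
have aE : 2 * a + 58 * g = 16 * (2 * w + 58 * g + 4 * rho1) + 58 * g.
  by rewrite /a; ring.
have conds2 : [/\ g * h <= 1, w * h <= 1, (c1 + (2 * a + 58 * g)) * h <= 4^-1,
    rho2 * h <= 8^-1 & c2 * u <= 2^-1].
  by rewrite aE; split => //; [clear -cgh|clear -rho2h|clear -c2h c2u]; lra.
have aC : 4 * (c1 + (2 * a + 58 * g)) * h <= C * h by rewrite aE ler_wpM2r.
have [[E2 VE hE2] [dV hV ndV] hq [nT nq nTk] Qq] := second_pass s0
  (And5 g0 w0 rho20 c10 a0) u01 uh hg1 hg2 conds2 aC hIO2 hQ hU QU fT fV eIO2.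
split => //.
have gu1 : g * u <= 1 by apply: le_trans gh; rewrite ler_wpM2l.
have hF1 := fl_addmul_le u01 hg3 g0 gu1 nS nT nSk fR1.
have hF2 := fl_mulmx_le u01 hg4 nTk nSk fRk.
have eR1 : R1 = S + T *m Sk + (R1 - (S + T *m Sk)) by rewrite addrC subrK.
have eRk : Rk = Tk *m Sk + (Rk - Tk *m Sk) by rewrite addrC subrK.
eexists; first exact: residual_expansion WE hW VE hV eR1 eRk.
have Q2 : norm2 Q <= 2.
  apply: le_trans (gram_norm2 (mulr_ge0 w0 u0) hQ) _.
  have wu : w * u <= w * h by rewrite ler_wpM2l.
  by clear -wu wh; lra.
(* The multiples of g u nu are 25 + 8 * 50 + 2 * 196 + 2 * 64 = 945, below the round figure 2000. *)
apply: le_trans (norm2D_le (norm2D_le (norm2D_le (norm2D_le hE1 ndW)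
  (norm2M_le (norm2D_le hE2 ndV) nSk)) (norm2M_le Q2 hF1)) (norm2M_le nq hF2)) _.
have nu0 : 0 <= nu by case/andP: sigma_nu => s1 s2; rewrite (le_trans (ltW s1)).
have : 0 <= g * u * nu by rewrite !mulr_ge0.
by clear; lra.
Qed.

End BlockColumn.

(** * Block matrices built by appending one block column *)

Section BlockRecursion.
Variable R : realType.

(** As all blocks have size s, the dependent pair indexing a block matrix is quotient and remainder
    by s; entries can then be compared through natural numbers. *)
Lemma tagnat_divn n s (t : 'I_(\sum_(j < n) s)) :
  (tagnat.sig1 t = t %/ s :> nat)%N /\ (tagnat.sig2 t = t %% s :> nat)%N.
Proof.
have tE : (t = tagnat.sig1 t * s + tagnat.sig2 t :> nat)%N.
  rewrite [LHS]tagnat.rect; congr (_ + _)%N.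
  by rewrite (big_ord_narrow (ltnW (ltn_ord (tagnat.sig1 t))))
    sum_nat_const card_ord.
have lt : (tagnat.sig2 t < s)%N by exact: ltn_ord.
have s0 : (0 < s)%N by exact: leq_ltn_trans lt.
by split; rewrite [in RHS]tE ?modnMDl ?modn_small // divnMDl // divn_small // addn0.
Qed.

Variables m s : nat.
Implicit Types (X : nat -> 'M[R]_(m, s)) (S : nat -> nat -> 'M[R]_s).

Lemma browE k X i (t : 'I_(\sum_(j < k) s)) (r : 'I_s) :
  (r = t %% s :> nat)%N -> brow k X i t = X (t %/ s)%N i r.
Proof.
by move=> rE; rewrite mxE; have [<- h] := tagnat_divn t;
  congr (X _ _ _); apply: val_inj; rewrite /= rE.
Qed.

Lemma bcol_aboveE k S (t : 'I_(\sum_(j < k) s)) (r : 'I_s) j :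
  (r = t %% s :> nat)%N -> bcol_above k S t j = S (t %/ s)%N k r j.
Proof.
by move=> rE; rewrite mxE; have [<- h] := tagnat_divn t;
  congr (S _ _ _ _); apply: val_inj; rewrite /= rE.
Qed.

Lemma bsquareE k S (t t' : 'I_(\sum_(j < k) s)) (r r' : 'I_s) :
  (r = t %% s :> nat)%N -> (r' = t' %% s :> nat)%N ->
  bsquare k S t t' = S (t %/ s)%N (t' %/ s)%N r r'.
Proof.
move=> rE r'E; rewrite mxE; have [<- h] := tagnat_divn t.
by have [<- h'] := tagnat_divn t'; congr (S _ _ _ _); apply: val_inj;
  rewrite /= ?rE ?r'E.
Qed.

Lemma sum_block_recr k : (\sum_(j < k) s + s = \sum_(j < k.+1) s)%N.
Proof. by rewrite big_ord_recr. Qed.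

Lemma block_index_last k t (l : 'I_s) :
  (t = \sum_(j < k) s + l)%N -> (t %/ s = k)%N /\ (t %% s = l)%N.
Proof.
rewrite sum_nat_const card_ord => ->.
have s0 := leq_ltn_trans (leq0n l) (ltn_ord l).
by rewrite divnMDl // modnMDl divn_small // modn_small // addn0.
Qed.

Lemma mod_block k (t : 'I_(\sum_(j < k) s)) : exists r : 'I_s, (r = t %% s :> nat)%N.
Proof. by have [_ <-] := tagnat_divn t; exists (tagnat.sig2 t). Qed.

Lemma brow_recr k X : brow k.+1 X =
  castmx (erefl, sum_block_recr k) (row_mx (brow k X) (X k)).
Proof.
apply/matrixP => i t; rewrite castmxE cast_ord_id.
have [r rE] := mod_block t; rewrite (browE _ _ rE) mxE.
case: splitP => [t0 | l] /= tE.
  by rewrite tE; apply/esym/browE; rewrite rE tE.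
have [-> tl] := block_index_last tE; congr (X k _ _).
by apply: val_inj; rewrite /= rE.
Qed.

Lemma bsquare_recr k S : (forall j, (j < k)%N -> S k j = 0) -> bsquare k.+1 S =
  castmx (sum_block_recr k, sum_block_recr k)
    (block_mx (bsquare k S) (bcol_above k S) 0 (S k k)).
Proof.
move=> S0; apply/matrixP => t t'; rewrite castmxE.
have [r rE] := mod_block t; have [r' r'E] := mod_block t'.
rewrite (bsquareE _ rE r'E) mxE.
case: splitP => [t0 | l] /= tE; rewrite mxE; case: splitP => [t0' | l'] /= tE'.
- by rewrite tE tE'; apply/esym/bsquareE; rewrite ?rE ?r'E ?tE ?tE'.
- have [-> tl] := block_index_last tE'.
  have -> : r' = l' by apply: val_inj; rewrite /= r'E.
  by rewrite tE; apply/esym/bcol_aboveE; rewrite rE tE.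
- have [-> tl] := block_index_last tE; rewrite S0 ?mxE // tE'.
  by have [<- _] := tagnat_divn t0'.
have [-> tl] := block_index_last tE; have [-> tl'] := block_index_last tE'.
by congr (S k k _ _); apply: val_inj; rewrite /= ?rE ?r'E.
Qed.

Lemma brow_prefix_bounds p k X a : (k <= p)%N -> lowerb a (brow p X) ->
  lowerb a (brow k X) /\ norm2 (brow k X) <= norm2 (brow p X).
Proof.
elim: p => [|p IH]; first by rewrite leqn0 => /eqP ->.
rewrite leq_eqVlt => /orP[/eqP -> // | kp]; rewrite brow_recr.
case: _ / (sum_block_recr p); rewrite castmx_id => low.
have [h1 h2] := IH kp (lowerb_lsub low).
by split => //; apply: le_trans h2 (norm2_lsub _ _).
Qed.

(** The total size is a variable [N], so that destructing [e] removes all casts. *)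
Lemma append_block_column n N (e : (n + s = N)%N) (X Q : 'M[R]_(m, n))
    (x q : 'M[R]_(m, s)) (Rm : 'M[R]_n) (R1 : 'M[R]_(n, s)) (Rk : 'M[R]_s)
    (XN QN : 'M[R]_(m, N)) (RN : 'M[R]_N) (r r' a b c : R) :
  XN = castmx (erefl, e) (row_mx X x) -> QN = castmx (erefl, e) (row_mx Q q) ->
  RN = castmx (e, e) (block_mx Rm R1 0 Rk) ->
  (exists2 dX, X + dX = Q *m Rm & norm2 dX <= r) ->
  (exists2 dx, x + dx = Q *m R1 + q *m Rk & norm2 dx <= r') ->
  norm2 (1%:M - Q^T *m Q) <= a -> norm2 (Q^T *m q) <= b ->
  norm2 (1%:M - q^T *m q) <= c ->
  (exists2 dXN, XN + dXN = QN *m RN & norm2 dXN <= r + r') /\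
  norm2 (1%:M - QN^T *m QN) <= a + 2 * b + c.
Proof.
case: N / e XN QN RN => XN QN RN; rewrite !castmx_id => -> -> ->.
move=> [dX hX ndX] [dx hx ndx] ha hb hc; split; last exact: gram_row_mx.
exists (row_mx dX dx).
  by rewrite add_row_mx mul_row_block mulmx0 addr0 hX hx.
by apply: le_trans (norm2_row_mx _ _) _; exact: lerD.
Qed.

End BlockRecursion.

(** * Induction on the number of block columns *)

Section Induction.
Variables (R : realType) (m s : nat).

(** The constants precede p, u, the matrices and the routines, so they are uniform. The threshold of
    the routines is stated with any [C'] above [C], because every prefix must work with the constant
    of the full matrix. *)
Lemma bcgsiA_induction (rA oA r1 c1 r2 c2 : R) (k : nat) :
  (0 < s)%N -> [/\ 0 <= rA & 0 <= oA] ->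
  [/\ 0 <= r1, 0 <= r2, 0 <= c1 & 0 <= c2] ->
  exists C r w : R, [/\ 1 <= C, 0 <= r, 0 <= w &
    forall (p : nat) (C' u h sigma nu : R) (IOA IO1 IO2 : io_routine R m s)
      (X Q U : nat -> 'M[R]_(m, s)) (S T RR : nat -> nat -> 'M[R]_s),
    (k <= p)%N -> C <= C' -> C' * h <= 1 ->
    0 <= u -> 0 < sigma <= nu -> u <= h -> u * nu <= h * sigma ->
    lowerb sigma (brow p X) -> norm2 (brow p X) <= nu ->
    io_bounds IOA (nu / sigma) (rA * u) (oA * u) ->
    io_bounds IO1 ((1 + C' * h) * (nu / sigma)) (r1 * u) (c1 * h) ->
    io_bounds IO2 (1 + C' * h) (r2 * u) (c2 * u) ->
    IOA (X 0%N) = (Q 0%N, RR 0%N 0%N) ->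
    (forall j, (0 < j < p)%N -> bcgsiA_step u IO1 IO2 X Q U S T RR j) ->
    (forall i j, (j < i < p)%N -> RR i j = 0) ->
    (exists2 dX, brow k X + dX = brow k Q *m bsquare k RR & norm2 dX <= r * u * nu)
    /\ norm2 (1%:M - (brow k Q)^T *m brow k Q) <= w * u].
Proof.
move=> s0 [rA0 oA0] [r10 r20 c10 c20]; elim: k => [|k [C [r [w [C1 r0 w0 IH]]]]].
  exists 1, 0, 0; split => // p C' u h sigma nu IOA IO1 IO2 X Q U S T RR *.
  rewrite !mul0r; split; last by rewrite norm2_norows // big_ord0.
  exists 0; last by rewrite -norm2_tr norm2_norows // big_ord0.
  by apply/matrixP => i j; have := ltn_ord j; rewrite [X in (_ < X)%N]big_ord0.
set n := (\sum_(j < k) s)%N.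
pose g := fl_const R n m s + fl_const R m n s + fl_const R n s s + fl_const R s s s.
have f0 a b c : 0 <= fl_const R a b c by exact: fl_const_ge0.
have f1 := f0 n m s; have f2 := f0 m n s; have f3 := f0 n s s; have f4 := f0 s s s.
have g0 : 0 <= g by rewrite /g !addr_ge0.
have hg : [/\ fl_const R n m s <= g, fl_const R m n s <= g,
    fl_const R n s s <= g & fl_const R s s s <= g].
  by rewrite /g; clear -f1 f2 f3 f4; split; lra.
pose D := g + w + 4 * (r + 29 * g) + 16 * r1 + 8 * r2 + 2 * c2
    + 4 * (c1 + (16 * (2 * w + 58 * g + 4 * r1) + 58 * g)).
have D0 : 0 <= D by rewrite /D; clear -g0 w0 r0 r10 r20 c10 c20; lra.
(* The first block column costs [rA] and [oA], every other one the bounds of [block_column_step];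
   adding both gives one formula for all k. *)
exists (C + D), (r + rA + (2000 * g + 2 * r1 + 16 * r2)),
  (w + 2 * (8 * (4 * w + 116 * g + 4 * r2)) + (oA + c2)).
have e1 : 0 <= 2000 * g + 2 * r1 + 16 * r2 by clear -g0 r10 r20; lra.
have e2 : 0 <= 8 * (4 * w + 116 * g + 4 * r2) by clear -g0 w0 r20; lra.
split; [by clear -C1 D0; lra|by clear -r0 rA0 e1; lra|
  by clear -w0 e2 oA0 c20; lra|].
move=> p C' u h sigma nu IOA IO1 IO2 X Q U S T RR kp CD Ch u0 sn uh unu low up
  hIOA hIO1 hIO2 eA steps lowtri.
have h0 : 0 <= h by exact: le_trans uh.
(* Here [1 <= C] is used: u <= h <= C' h <= 1. *)
have u01 : 0 <= u <= 1.
  rewrite u0 /=; apply: le_trans uh _; apply: le_trans Ch.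
  by rewrite ler_peMl //; clear -C1 D0 CD; lra.
have [sig0 signu] : 0 < sigma /\ sigma <= nu by apply/andP.
have nu0 : 0 <= nu by rewrite (le_trans _ signu) ?ltW.
have CC' : C <= C' by clear -CD D0; lra.
have [hX hQ] := IH p C' u h sigma nu IOA IO1 IO2 X Q U S T RR (ltnW kp) CC' Ch u0
  sn uh unu low up hIOA hIO1 hIO2 eA steps lowtri.
have [lowk upk] := brow_prefix_bounds kp low.
have [lowk1 upk1] : lowerb sigma (row_mx (brow k X) (X k)) /\
    norm2 (row_mx (brow k X) (X k)) <= nu.
  move: lowk upk; rewrite brow_recr; case: _ / (sum_block_recr s k).
  by rewrite castmx_id => l1 l2; split => //; exact: le_trans up.
have nXk : norm2 (X k) <= nu := le_trans (norm2_rsub _ _) upk1.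
have lowXk : lowerb sigma (X k) := lowerb_rsub lowk1.
have [dx_ex Qq qq] : [/\ exists2 dx, X k + dx =
        brow k Q *m bcol_above k RR + Q k *m RR k k &
        norm2 dx <= (rA + (2000 * g + 2 * r1 + 16 * r2)) * u * nu,
      norm2 ((brow k Q)^T *m Q k) <= 8 * (4 * w + 116 * g + 4 * r2) * u &
      norm2 (1%:M - (Q k)^T *m Q k) <= (oA + c2) * u].
  have [k0|k_gt0] := posnP k.
    have kY : (kappa (X k) <= (nu / sigma)%:E)%E.
      by apply: (kappa_le s0 sig0 lowXk nXk); rewrite divfK ?gt_eqF.
    have eAk : IOA (X k) = (Q k, RR k k) by rewrite k0.
    have n0 : n = 0%N by rewrite /n k0 big_ord0.
    have [] := hIOA _ kY; rewrite /io_residual_le eAk /= => -[dx hx ndx] hq; split.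
    - exists dx.
        rewrite hx; suff -> : brow k Q *m bcol_above k RR = 0 by rewrite add0r.
        apply/matrixP => i j; rewrite !mxE big1 // => l _.
        by have := ltn_ord l; rewrite [X in (_ < X)%N]n0.
      apply: le_trans ndx _; rewrite -!mulrA.
      by rewrite ler_pM ?mulr_ge0 ?norm2_ge0 ?lerDl // ler_wpM2l.
    - by rewrite norm2_norows // mulr_ge0.
    by apply: le_trans hq _; rewrite ler_wpM2r // lerDl.
  have kp0 : (0 < k < p)%N by rewrite k_gt0.
  have [W [V [fS [fW eIO1] fT [fV eIO2] [fR1 fRk]]]] := steps k kp0.
  have [dX XQ ndX] := hX.
  have DC : D <= C' by clear -CD C1; lra.
  have [[dx hx ndx] Qq qq] := block_column_step s0 (And3 g0 w0 r0)
    (And4 r10 r20 c10 c20) u01 sn uh unu hg Ch DC hIO1 hIO2 lowk1 nXk XQ ndX hQ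
    fS fW eIO1 fT fV eIO2 fR1 fRk.
  split => //.
    exists dx => //; apply: le_trans ndx _.
    by rewrite ler_wpM2r // ler_wpM2r // lerDr.
  by apply: le_trans qq _; rewrite ler_wpM2r // lerDr.
have tri j : (j < k)%N -> RR k j = 0 by move=> jk; apply: lowtri; rewrite jk.
have [hX' hQ'] := append_block_column (brow_recr k X) (brow_recr k Q)
  (bsquare_recr tri) hX dx_ex hQ Qq qq.
split.
  by have [dX e n'] := hX'; exists dX => //; apply: le_trans n' _; clear; lra.
by apply: le_trans hQ' _; clear; lra.
Qed.

End Induction.

(** * From powers of the condition number to fixed bounds *)

Section RoutineHypotheses.
Variable R : realType.

Lemma kappa_ge0 m n (A : 'M[R]_(m, n)) : (0 < n)%N -> (0 <= kappa A)%E.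
Proof.
move=> n0; have [->//|kN] := eqVneq (kappa A) +oo%E.
have [sigma s0 [_ ->]] := kappa_fin n0 kN.
by rewrite lee_fin divr_ge0 ?norm2_ge0 // ltW.
Qed.

Lemma poweR_kappa_le m n (A : 'M[R]_(m, n)) (alpha t : R) : (0 < n)%N ->
  0 <= alpha -> (kappa A <= t%:E)%E -> (kappa A `^ alpha <= (t `^ alpha)%:E)%E.
Proof.
move=> n0 a0 kt; rewrite -poweR_EFin.
have k0 := kappa_ge0 A n0; have t0 := le_trans k0 kt.
by apply: gt0_ler_poweR; rewrite ?in_itv /= ?k0 ?t0 ?leey.
Qed.

Lemma io_residual_le_mono m s (IO : io_routine R m s) b b' Y :
  b <= b' -> io_residual_le IO b Y -> io_residual_le IO b' Y.
Proof.
move=> bb' [dY e n]; exists dY => //; apply: le_trans n _.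
by rewrite ler_wpM2r ?norm2_ge0.
Qed.

(** The given constants may be negative, hence the maxima with 0. The second level t' serves IO_2:
    assumed good up to t, it is applied only below 1 + C h, where the power is bounded by a
    constant. *)
Lemma io_bounds_of_power m s (IO : io_routine R m s) (u r o alpha t t' : R) :
  (0 < s)%N -> 0 <= u -> 0 <= alpha -> t' <= t ->
  (forall Y : 'M[R]_(m, s), (kappa Y <= t%:E)%E ->
     io_residual_le IO (r * u) Y /\
     ((norm2 (1%:M - (IO Y).1^T *m (IO Y).1))%:E <=
      (o * u)%:E * kappa Y `^ alpha)%E) ->
  io_bounds IO t' (Num.max 0 r * u) (Num.max 0 o * u * t' `^ alpha).
Proof.
move=> s0 u0 a0 tt' h Y kY; have [|h1 h2] := h Y.
  by apply: le_trans kY _; rewrite lee_fin.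
split; first by apply: io_residual_le_mono h1; rewrite ler_wpM2r // le_max lexx orbT.
rewrite -lee_fin; apply: le_trans h2 _; rewrite (EFinM (Num.max 0 o * u)).
apply: (@le_trans _ _ ((Num.max 0 o * u)%:E * kappa Y `^ alpha)%E).
  rewrite lee_wpmul2r ?poweR_ge0 // lee_fin ler_wpM2r //.
  by rewrite le_max lexx orbT.
by rewrite lee_wpmul2l ?poweR_kappa_le // lee_fin mulr_ge0 // le_max lexx.
Qed.

Lemma io_bounds_mono m s (IO : io_routine R m s) t r b b' :
  b <= b' -> io_bounds IO t r b -> io_bounds IO t r b'.
Proof.
by move=> bb' h Y kY; have [h1 h2] := h Y kY; split=> //; exact: le_trans bb'.
Qed.

Lemma powR_le2M (x y alpha theta : R) : 0 <= alpha <= theta -> 1 <= x ->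
  0 <= y <= 2 * x -> y `^ alpha <= 2 `^ alpha * x `^ theta.
Proof.
move=> /andP[a0 at_] x1 /andP[y0 yx]; have x0 : 0 <= x := le_trans ler01 x1.
apply: (@le_trans _ _ ((2 * x) `^ alpha)).
  by rewrite ge0_ler_powR // nnegrE // mulr_ge0.
by rewrite powRM // ler_wpM2l ?powR_ge0 // ler_powR.
Qed.

End RoutineHypotheses.

(* The constants in the assumptions on the routines (rA, oA, r1, o1, r2, o2)
   are given; the constant C of the condition O(eps) kappa^theta < 1 and the
   constants Cres, Corth of the conclusions depend only on those, on m, s, p
   and on the exponents. For IO1 and IO2 the bound kappa Y <= kappa XX is
   understood up to the factor 1 + O(eps) kappa^theta(XX): these routines are
   applied to rounded matrices, whose condition number can exceed kappa XX by
   such a factor. *)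
Theorem theorem2 (R : realType) (m s p : nat) (alpha1 alpha2 : R)
    (rA oA r1 o1 r2 o2 : R) :
  (0 < m)%N -> (0 < s)%N -> (0 < p)%N -> (p * s <= m)%N ->
  0 <= alpha1 -> 0 <= alpha2 ->
  let theta := Num.max alpha1 1 in
  exists C Cres Corth : R,
    [/\ 0 < C, 0 < Cres, 0 < Corth &
    forall (eps : R) (IOA IO1 IO2 : io_routine R m s)
      (XX QQ : 'M[R]_(m, (\sum_(j < p) s)%N))
      (RR : 'M[R]_((\sum_(i < p) s)%N, (\sum_(j < p) s)%N)),
      0 < eps ->
      let eta : \bar R := ((C * eps)%:E * kappa XX `^ theta)%E in
      (forall Y : 'M[R]_(m, s), (kappa Y <= kappa XX)%E ->
         io_residual_le IOA (rA * eps) Y /\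
         norm2 (1%:M - (IOA Y).1^T *m (IOA Y).1) <= oA * eps) ->
      (forall Y : 'M[R]_(m, s), (kappa Y <= (1 + eta) * kappa XX)%E ->
         io_residual_le IO1 (r1 * eps) Y /\
         ((norm2 (1%:M - (IO1 Y).1^T *m (IO1 Y).1))%:E
            <= (o1 * eps)%:E * kappa Y `^ alpha1)%E) ->
      (forall Y : 'M[R]_(m, s), (kappa Y <= (1 + eta) * kappa XX)%E ->
         io_residual_le IO2 (r2 * eps) Y /\
         ((norm2 (1%:M - (IO2 Y).1^T *m (IO2 Y).1))%:E
            <= (o2 * eps)%:E * kappa Y `^ alpha2)%E) ->
      (eta < 1)%E ->
      bcgsiA_computed eps IOA IO1 IO2 XX QQ RR ->
      (exists2 dXX : 'M[R]_(m, (\sum_(j < p) s)%N),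
         XX + dXX = QQ *m RR & norm2 dXX <= Cres * eps * norm2 XX) /\
      norm2 (1%:M - QQ^T *m QQ) <= Corth * eps].
Proof.
move=> _ s0 p0 _ a1 a2 theta.
have max0 (x : R) : 0 <= Num.max 0 x by rewrite le_max lexx.
have pow0 (x : R) : 0 <= Num.max 0 x * 2 `^ alpha1 by rewrite mulr_ge0 ?powR_ge0.
have pow0' (x : R) : 0 <= Num.max 0 x * 2 `^ alpha2 by rewrite mulr_ge0 ?powR_ge0.
have [C [r [w [C1 r0 w0 main]]]] := bcgsiA_induction m p s0
  (conj (max0 rA) (max0 oA)) (And4 (max0 r1) (max0 r2) (pow0 o1) (pow0' o2)).
have C0 : 0 < C := lt_le_trans ltr01 C1.
exists C, (r + 1), (w + 1); split; rewrite ?ltr_wpDl //.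
move=> u IOA IO1 IO2 XX QQ RRR u_gt0 eta hA h1 h2 eta1.
move=> [X [Q [U [S [T [RR [[XE -> ->] eA steps lowtri]]]]]]].
have u0 := ltW u_gt0.
have theta1 : 1 <= theta by rewrite le_max lexx orbT.
have theta0 : 0 < theta := lt_le_trans ltr01 theta1.
have Cu0 : 0 < C * u by rewrite mulr_gt0.
(* An infinite kappa would make [eta] infinite, as C eps > 0 and theta > 0. *)
have XX_fin : kappa XX != +oo%E.
  apply: contraTN eta1 => /eqP k; rewrite /eta k poweRyr ?gt_eqF //.
  by rewrite gt0_muley ?lte_fin // -leNgt leey.
have cols : (0 < \sum_(j < p) s)%N by rewrite sum_nat_const card_ord muln_gt0 p0.
have [sigma sig0 [low kE]] := kappa_fin cols XX_fin.
set nu := norm2 XX in kE; set K := nu / sigma in kE.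
have signu : sigma <= nu := lowerb_le_norm2 cols low.
have K1 : 1 <= K by rewrite ler_pdivlMr ?mul1r.
have K0 : 0 <= K := le_trans ler01 K1.
(* theta >= 1 and K >= 1 give u K <= h, and theta >= alpha1 bounds the loss of IO_1 by a multiple of
   h. *)
pose h := u * K `^ theta.
have etaE : eta = (C * h)%:E by rewrite /eta kE poweR_EFin -EFinM mulrA.
have Kth : K <= K `^ theta by exact: le1r_powR.
have uh : u <= h by rewrite ler_peMr // (le_trans K1).
have unu : u * nu <= h * sigma.
  have -> : nu = K * sigma by rewrite divfK ?gt_eqF.
  by rewrite mulrA ler_wpM2r ?(ltW sig0) // ler_wpM2l.
have Ch : C * h < 1 by rewrite -lte_fin -etaE.
have Ch0 : 0 <= C * h by rewrite mulr_ge0 ?(ltW C0) // (le_trans u0).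
have limE : ((1 + eta) * kappa XX)%E = ((1 + C * h) * K)%:E by rewrite etaE kE.
rewrite limE in h1 h2; rewrite kE in hA.
have ChK : 0 <= (1 + C * h) * K <= 2 * K.
  by rewrite mulr_ge0 //= ?ler_wpM2r //; clear -Ch Ch0; lra.
have bA : io_bounds IOA K (Num.max 0 rA * u) (Num.max 0 oA * u).
  move=> Y kY; have [hA1 hA2] := hA Y kY; split.
    by apply: io_residual_le_mono hA1; rewrite ler_wpM2r // le_max lexx orbT.
  by apply: le_trans hA2 _; rewrite ler_wpM2r // le_max lexx orbT.
have b1 : io_bounds IO1 ((1 + C * h) * K) (Num.max 0 r1 * u)
    (Num.max 0 o1 * 2 `^ alpha1 * h).
  apply: io_bounds_mono (io_bounds_of_power s0 u0 a1 (lexx _) h1).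
  rewrite /h -!mulrA ler_wpM2l // [leRHS]mulrCA ler_wpM2l //.
  by apply: powR_le2M => //; rewrite a1 le_max lexx.
have b2 : io_bounds IO2 (1 + C * h) (Num.max 0 r2 * u)
    (Num.max 0 o2 * 2 `^ alpha2 * u).
  have tK : 1 + C * h <= (1 + C * h) * K by rewrite ler_peMr // addr_ge0.
  apply: io_bounds_mono (io_bounds_of_power s0 u0 a2 tK h2).
  rewrite mulrAC ler_wpM2r // ler_wpM2l //.
  rewrite ge0_ler_powR // ?nnegrE //; clear -Ch Ch0; lra.
have up : norm2 (brow p X) <= nu by rewrite /nu XE.
have sn : 0 < sigma <= nu by rewrite sig0.
have lowX : lowerb sigma (brow p X) by rewrite -XE.
have [[dX dXE ndX] orth] := main p C u h sigma nu IOA IO1 IO2 X Q U S T RR (leqnn p)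
  (lexx C) (ltW Ch) u0 sn uh unu lowX up bA b1 b2 eA steps lowtri.
split.
  exists dX; first by rewrite XE.
  apply: le_trans ndX _; rewrite ler_wpM2r ?norm2_ge0 // ler_wpM2r // lerDl.
  exact: ler01.
by apply: le_trans orth _; rewrite ler_wpM2r // lerDl.
Qed.
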